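(* Let $b=\rho\,\Phi\in C^1_\sharp(Y_d)^d$, where $\rho\in C^1_\sharp(Y_d)$ is non negative, not identically zero, and vanishes at some point of $Y_d$, and $\Phi\in C^1_\sharp(Y_d)^d$ is a non vanishing vector field (i.e. $\Phi(x)\neq0_{\mathbb{R}^d}$ for every $x$). Assume that there exists a sequence $(\rho_n)_{n\in\mathbb{N}}$ in $C^1_\sharp(Y_d)$ such that (i) for any $n\in\mathbb{N}$, $\rho\le\rho_n$ and $\rho_n>0$ in $Y_d$, and $(\rho_n)_{n\in\mathbb{N}}$ converges uniformly to $\rho$ on $Y_d$; (ii) for any $n\in\mathbb{N}$, $\mathsf{C}_{b_n}=\{\zeta_n\}$ for some $\zeta_n\in\mathbb{R}^d$, where $b_n:=\rho_n\,\Phi$. Let $\zeta:=\lim_{n\to\infty}\zeta_n$ (this limit exists under these assumptions). Let $X$ be the flow associated with $b$, let $\pi$ be the canonical projection from $\mathbb{R}^d$ onto the torus $Y_d$, and define for $x\in\mathbb{R}^d$ the set $F_x:=\overline{\pi\big(X(\mathbb{R},x)\big)}$, the closure in $Y_d$ of the projection on $Y_d$ of the orbit $X(\mathbb{R},x)$ of $x$. Then $$\forall\,x\in Y_d,\quad F_x\cap\{\rho=0\}=\emptyset\ \Rightarrow\ \lim_{t\to\infty}\frac{X(t,x)}{t}=\zeta.$$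
   Context: $Y_d=\mathbb{R}^d/\mathbb{Z}^d$ is the $d$-dimensional torus, identified with $[0,1)^d$. $C^k_\sharp(Y_d)$ is the space of real-valued $\mathbb{Z}^d$-periodic functions in $C^k(\mathbb{R}^d)$. For $b\in C^1_\sharp(Y_d)^d$, the flow $X:\mathbb{R}\times\mathbb{R}^d\to\mathbb{R}^d$ associated with $b$ is the solution of $\partial_t X(t,x)=b(X(t,x))$, $t\in\mathbb{R}$, $X(0,x)=x$; it satisfies $X(t,x+\kappa)=X(t,x)+\kappa$ for $\kappa\in\mathbb{Z}^d$, so it induces a flow on $Y_d$. A probability measure $\mu$ on $Y_d$ is invariant for the flow $X$ if $\int_{Y_d}\psi(X(t,y))\,d\mu(y)=\int_{Y_d}\psi(y)\,d\mu(y)$ for all $t\in\mathbb{R}$ and $\psi\in C^0_\sharp(Y_d)$; $\mathscr{I}_b$ denotes the set of these invariant probability measures. The (Herman) rotation set is $\mathsf{C}_b:=\left\{\int_{Y_d}b(y)\,d\mu(y):\mu\in\mathscr{I}_b\right\}\subset\mathbb{R}^d$. *)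

(* Defs.v *)
From HB Require Import structures.
From mathcomp Require Import all_boot all_order all_algebra.
From mathcomp Require Import generic_quotient.
From mathcomp Require Import all_classical all_reals all_analysis.

Set Implicit Arguments.
Unset Strict Implicit.
Unset Printing Implicit Defensive.

Import Order.TTheory GRing.Theory Num.Theory.
Import numFieldNormedType.Exports.

Local Open Scope classical_set_scope.
Local Open Scope ring_scope.
Local Open Scope quotient_scope.

(* [mxOver Num.int] is the lattice Z^d inside R^d. *)
Definition lattice_eq (R : realType) (d : nat) : rel 'rV[R]_d :=
  fun x y => x - y \is a mxOver Num.int.

Lemma lattice_eq_equiv (R : realType) (d : nat) :
  equiv_class_of (@lattice_eq R d).
Proof.
have trans : transitive (@lattice_eq R d).
  move=> y x z /mxOverP xy /mxOverP yz; apply/mxOverP => i j.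
  by rewrite -(subrKA y) mxE rpredD.
have sym x y : lattice_eq x y -> lattice_eq y x.
  by move=> /mxOverP xy; apply/mxOverP => i j; rewrite -opprB mxE rpredN.
split=> [x|x y|//]; last by apply/idP/idP; exact: sym.
by apply/mxOverP => i j; rewrite subrr mxE rpred0.
Qed.

Canonical lattice_eq_rel (R : realType) (d : nat) : equiv_rel 'rV[R]_d :=
  EquivRelPack (lattice_eq_equiv R d).

(* Y_d = R^d / Z^d with the quotient topology. *)
Definition torus (R : realType) (d : nat) : Type :=
  quotient_topology {eq_quot (@lattice_eq_rel R d)}.

HB.instance Definition _ (R : realType) (d : nat) := Quotient.on (torus R d).
HB.instance Definition _ (R : realType) (d : nat) :=
  PointedTopological.on (torus R d).

Definition torus_proj (R : realType) (d : nat) : 'rV[R]_d -> torus R d :=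
  \pi_(torus R d).

Definition periodic (R : realType) (d : nat) (T : Type)
    (f : 'rV[R]_d -> T) : Prop :=
  forall x k, k \is a mxOver Num.int -> f (x + k) = f x.

(* [repr y] is an arbitrary representative in R^d of the class [y]. The
   function induced on the torus is meaningful for Z^d-periodic [f], for which
   it does not depend on the choice of representatives. *)
Definition on_torus (R : realType) (d : nat) (T : Type)
    (f : 'rV[R]_d -> T) : torus R d -> T :=
  fun y => f (repr y).

Definition C0_per (R : realType) (d : nat) (f : 'rV[R]_d -> R) : Prop :=
  continuous f /\ periodic f.

(* In finite dimension, continuity of the differential amounts to continuity
   of x |-> 'D_v f x for every fixed direction v. *)
Definition C1_per (R : realType) (d : nat) (W : normedModType R)
    (f : 'rV[R]_d -> W) : Prop :=
  [/\ forall x, differentiable f x,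
      forall v, continuous (fun x => 'D_v f x)
    & periodic f].

Definition is_flow (R : realType) (d : nat) (b : 'rV[R]_d -> 'rV[R]_d)
    (X : R -> 'rV[R]_d -> 'rV[R]_d) : Prop :=
  forall x, X 0 x = x /\ forall t, is_derive (t : R) (1 : R) (X ^~ x) (b (X t x)).

Definition borel_torus (R : realType) (d : nat) :=
  g_sigma_algebraType (@open (torus R d)).

(* The flow is unique when [b] is C^1, so that "exists X" below stands for
   "the flow X associated with b". *)
Definition invariant_probability (R : realType) (d : nat)
    (b : 'rV[R]_d -> 'rV[R]_d) (mu : probability (borel_torus R d) R) : Prop :=
  exists2 X, is_flow b X &
    forall (t : R) (psi : 'rV[R]_d -> R), C0_per psi ->
      \int[mu]_y on_torus (fun x => psi (X t x)) y =
      \int[mu]_y on_torus psi y.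

Definition vector_integral (R : realType) (d : nat)
    (mu : probability (borel_torus R d) R) (b : 'rV[R]_d -> 'rV[R]_d)
    : 'rV[R]_d :=
  \row_i \int[mu]_y on_torus (fun x => b x 0 i) y.

Definition rotation_set (R : realType) (d : nat)
    (b : 'rV[R]_d -> 'rV[R]_d) : set 'rV[R]_d :=
  [set vector_integral mu b | mu in [set mu | invariant_probability b mu]].

Definition orbit_closure (R : realType) (d : nat)
    (X : R -> 'rV[R]_d -> 'rV[R]_d) (x : 'rV[R]_d) : set (torus R d) :=
  closure (@torus_proj R d @` range (X ^~ x)).

Definition zero_set (R : realType) (d : nat) (rho : 'rV[R]_d -> R)
    : set (torus R d) :=
  [set y | on_torus rho y = 0].

(* Main.v *)
Require Import Defs.
From HB Require Import structures.
From mathcomp Require Import all_boot all_order all_algebra.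
From mathcomp Require Import all_classical all_reals all_analysis.
From mathcomp Require Import measurable_realfun ring lra.

Set Implicit Arguments.
Unset Strict Implicit.
Unset Printing Implicit Defensive.

Import Order.TTheory GRing.Theory Num.Theory.
Import numFieldNormedType.Exports.

Local Open Scope classical_set_scope.
Local Open Scope ring_scope.

(** The field rho_n Phi is a positive multiple of rho_0 Phi, so the two have the
same orbits and differ only by the speed along them.  This is what makes the
rotation vectors comparable.

Fix an orbit u of the field r Phi, and a field r_1 Phi with r_1 > 0 and flow Y.
If T solves T' = r(u) / r_1(u), T(0) = 0, then Y(T(t), u(0)) and u(t) solve the
same Lipschitz equation, hence coincide (time_change): T(t) is the time shown by
the clock of r_1 Phi when the clock of r Phi shows t.  So
<<
  u(t) / t = (T(t) / t) * (Y(T(t), u(0)) / T(t)),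
>>
and an asymptotic velocity for r_1 Phi is transferred to u as soon as one
controls T(t) / t, the time average of r(u) / r_1(u).

That asymptotic velocity is provided by the assumption on the rotation sets.
If C_b = {zeta}, then X(t,x)/t tends to zeta for every x
(rotation_singleton_cvg).  Otherwise X(t,x)/t stays away from zeta for a set of
times that an ultrafilter U finer than t -> +oo contains.  The time averages of
continuous periodic functions along the orbit of x converge along U to a
positive linear functional, which is invariant under the flow because the
averages over [0,t] and over [s,t+s] differ by O(1/t).  By the Riesz
representation theorem (riesz_probability, torus_riesz) it is the integral for
an invariant probability measure on the torus.  Its value at b is the limit of
(X(t,x)-x)/t along U by the equation of the flow, and it is zeta by assumption:
a contradiction.  The flow of rho_n Phi itself comes with its rotation set: a
point of that set is the integral of the field for a measure that is invariant
under some flow of the field.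

The limit zeta exists (rotation_vectors_cvg).  Follow one orbit of rho_0 Phi.
With a_n the limit along an ultrafilter of the averages of rho_0 / rho_n, the
formula above gives zeta_0 = a_n zeta_n.  From rho_n <= rho + eps <= rho_N + eps
for n large one gets a_n >= a_N - o(1) for each fixed N, so that the 1 / a_n
converge to their infimum, and zeta_n = zeta_0 / a_n converges with them.

Finally let the orbit closure of x avoid the zeros of rho.  It is compact, so
rho is at least some c > 0 along the orbit (orbit_closure_lower_bound), and then
rho / rho_n is uniformly close to 1 there for n large.  Hence T(t) / t is close
to 1, and X(t,x)/t is eventually close to zeta_n, thus to zeta
(positive_orbit_cvg). *)

(** * Periodic functions on the Euclidean space *)

Lemma rV_norm_coord (R : realType) (d : nat) (x : 'rV[R]_d) (i : 'I_d) :
  `|x 0 i| <= `|x|.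
Proof.
have -> : `|x| = mx_norm x by [].
rewrite mx_normrE; exact: (le_bigmax _ (fun i => `|x i.1 i.2|) (ord0, i)).
Qed.

Lemma rV_norm_le (R : realType) (d : nat) (x : 'rV[R]_d) (c : R) :
  0 <= c -> (forall i, `|x 0 i| <= c) -> `|x| <= c.
Proof.
move=> c0 xc; have -> : `|x| = mx_norm x by [].
rewrite mx_normrE; apply/bigmax_leP; split=> // -[i j] _ /=.
by rewrite ord1.
Qed.

Lemma unit_cube_compact (R : realType) (d : nat) :
  compact [set x : 'rV[R]_d | forall i, `[0, 1]%classic (x 0 i)].
Proof.
apply: (@rV_compact R d (fun=> `[0, 1]%classic)) => i.
exact: segment_compact.
Qed.

Lemma unit_cube_translate (R : realType) (d : nat) (x : 'rV[R]_d) :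
  exists2 k, k \is a mxOver Num.int & forall i, `[0, 1]%classic ((x + k) 0 i).
Proof.
exists (\row_i - (Num.floor (x 0 i))%:~R).
  by apply/mxOverP => i j; rewrite mxE rpredN intr_int.
move=> i /=; rewrite !mxE in_itv /= subr_ge0 floor_le /=.
by rewrite lerBlDr addrC -[1 in leRHS]/1%:~R -intrD ltW // floorD1_gt.
Qed.

(** Every point has an integer translate in the compact unit cube. *)
Lemma periodic_bounded (R : realType) (d : nat) (W : normedModType R)
    (f : 'rV[R]_d -> W) :
  continuous f -> Defs.periodic f -> exists2 M, 0 < M & forall x, `|f x| <= M.
Proof.
move=> cf pf; set Q := [set x : 'rV[R]_d | forall i, `[0, 1]%classic (x 0 i)].
have [c _ cM] : exists2 c, c \in Q & forall t, t \in Q -> `|f t| <= `|f c|.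
  apply: (@EVT_max_rV R d (fun x => `|f x|) Q).
  - by have [k _ Qk] := unit_cube_translate (0 : 'rV[R]_d); exists (0 + k).
  - exact: unit_cube_compact.
  - apply: continuous_subspaceT => x; apply: continuous_comp; first exact: cf.
    exact: norm_continuous.
exists (`|f c| + 1); first by rewrite ltr_wpDl.
move=> x; have [k kZ Qk] := unit_cube_translate x.
rewrite -(pf x k kZ); apply: le_trans (cM _ _) _; last by rewrite lerDl.
by rewrite inE.
Qed.

Lemma is_derive_coord (R : realType) (d : nat) (V : normedModType R)
    (u : V -> 'rV[R]_d) (t v : V) (u' : 'rV[R]_d) (i : 'I_d) :
  is_derive t v u u' -> is_derive t v (fun s => u s 0 i) (u' 0 i).
Proof.
move=> [du u'E]; split; first by move/derivable_mxP : du; exact.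
by rewrite -u'E derive_mx // mxE.
Qed.

Lemma is_derive_line (R : realType) (d : nat) (f : 'rV[R]_d -> R)
    (x v : 'rV[R]_d) (s : R) : (forall x, differentiable f x) ->
  is_derive s 1 (fun s : R => f (x + s *: v)) ('D_v f (x + s *: v)).
Proof.
move=> df; set g := fun s : R => x + s *: v.
have gd : is_diff s g (fun h => h *: v).
  rewrite /g; apply: is_diff_eq.
  by rewrite add0r.
have fg : is_diff s (f \o g) ('d f (g s) \o (fun h => h *: v)).
  have ? : is_diff (g s) f ('d f (g s)) by apply/differentiableP.
  exact: is_diff_comp.
split; first exact/derivable1_diffP.
rewrite deriveE; last by case: fg.
by rewrite diff_val /= scale1r deriveE.
Qed.

(** The partial derivatives are continuous and periodic, hence bounded, and the
differential expresses each directional derivative through them. *)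
Lemma derive_bound (R : realType) (d : nat) (f : 'rV[R]_d -> R) :
  C1_per f -> exists2 M, 0 < M & forall x v, `|'D_v f x| <= M * `|v|.
Proof.
move=> [df cDf pf].
have pD v : Defs.periodic (fun x => 'D_v f x).
  move=> x k kZ; rewrite /derive pf //.
  suff -> : f \o shift (x + k) = f \o shift x by [].
  by apply/funext => h /=; rewrite addrA pf.
have /choice[M HM] : forall i : 'I_d, exists M,
    0 < M /\ forall x, `|'D_(delta_mx 0 i) f x| <= M.
  move=> i; have [M M0 HM] := periodic_bounded (cDf (delta_mx 0 i)) (pD _).
  by exists M.
exists (1 + \sum_i M i).
  by rewrite ltr_pwDl // sumr_ge0 // => i _; case: (HM i) => /ltW.
move=> x v; rewrite deriveE // [v in 'd f x v]row_sum_delta.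
rewrite linear_sum /= (le_trans (ler_norm_sum _ _ _)) //.
rewrite mulrDl mul1r mulr_suml -[leLHS]add0r lerD // ler_sum // => i _.
rewrite linearZ /= normrM mulrC ler_pM //; last exact: rV_norm_coord.
by rewrite -deriveE //; case: (HM i).
Qed.

(** Mean value theorem along the segment from [y] to [x]. *)
Lemma C1_per_lipschitz_scalar (R : realType) (d : nat) (f : 'rV[R]_d -> R) :
  C1_per f -> exists2 K, 0 < K & forall x y, `|f x - f y| <= K * `|x - y|.
Proof.
move=> fC1; have [df _ _] := fC1; have [M M0 HM] := derive_bound fC1.
exists M => // x y.
have dg (s : R) := is_derive_line y (x - y) s df.
have [|c _] := @MVT R _ _ 0 1 ltr01 (fun s _ => dg s).
  apply: continuous_subspaceT => s.
  by apply: differentiable_continuous; apply/derivable1_diffP; case: (dg s).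
rewrite scale1r scale0r addr0 subrKC subr0 mulr1 => ->.
exact: HM.
Qed.

Lemma C1_per_coord (R : realType) (d m : nat) (f : 'rV[R]_d -> 'rV[R]_m)
    (i : 'I_m) : C1_per f -> C1_per (fun x => f x 0 i).
Proof.
move=> [df cDf pf]; split.
- move=> x.
  apply: (differentiable_comp (f := f) (g := fun y : 'rV_m => y 0 i)) => //.
  exact: differentiable_coord.
- move=> v x; have -> : 'D_v (fun x => f x 0 i) = (fun x => 'D_v f x 0 i).
    apply/funext => y; rewrite derive_mx ?mxE //.
    exact: diff_derivable.
  apply: (continuous_comp (f := fun x => 'D_v f x)
    (g := fun y : 'rV_m => y 0 i)); first exact: cDf.
  exact: coord_continuous.
- by move=> x k kZ; rewrite pf.
Qed.

Lemma C1_per_lipschitz (R : realType) (d m : nat) (f : 'rV[R]_d -> 'rV[R]_m) :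
  C1_per f -> exists2 K, 0 < K & forall x y, `|f x - f y| <= K * `|x - y|.
Proof.
move=> fC1.
have /choice[K HK] : forall i : 'I_m, exists K,
    0 < K /\ forall x y, `|f x 0 i - f y 0 i| <= K * `|x - y|.
  move=> i; have [K K0 HK] := C1_per_lipschitz_scalar (C1_per_coord i fC1).
  by exists K.
have S0 : 0 <= \sum_i K i by rewrite sumr_ge0 // => i _; case: (HK i) => /ltW.
exists (1 + \sum_i K i); first by rewrite ltr_pwDl.
move=> x y; apply: rV_norm_le; first by rewrite mulr_ge0 // addr_ge0.
move=> i; rewrite !mxE; have [K0 /(_ x y)/le_trans] := HK i; apply.
rewrite ler_wpM2r // (bigD1 i) //= addrCA lerDl addr_ge0 // sumr_ge0 // => j _.
by case: (HK j) => /ltW.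
Qed.

Lemma C1_per_continuous (R : realType) (d : nat) (W : normedModType R)
  (f : 'rV[R]_d -> W) : C1_per f -> continuous f.
Proof. by move=> [df _ _] x; exact: differentiable_continuous. Qed.

(** * Differential inequalities and uniqueness for Lipschitz equations *)

Lemma regular_scaleE (R : realType) (a b : R) : a *: b = a * b.
Proof. by []. Qed.

Lemma is_derive_continuous (R : realType) (W : normedModType R) (f : R -> W)
    (t : R) (f' : W) :
  is_derive t 1 f f' -> {for t, continuous f}.
Proof.
by case=> df _; apply: differentiable_continuous; exact/derivable1_diffP.
Qed.

Lemma derive_le_increment (R : realType) (f g f' g' : R -> R) (a b : R) :
  (forall t : R, is_derive t 1 f (f' t)) ->
  (forall t : R, is_derive t 1 g (g' t)) ->
  a <= b -> (forall t, a <= t <= b -> f' t <= g' t) ->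
  f b - f a <= g b - g a.
Proof.
move=> df dg ab fg.
have dh (t : R) : is_derive t 1 (g - f) (g' t - f' t) by exact: is_deriveB.
have [|c cab E] := MVT_segment ab (fun t _ => dh t).
  by apply: continuous_subspaceT => t; exact: is_derive_continuous (dh t).
rewrite -subr_ge0 (_ : _ - _ = (g - f) b - (g - f) a).
  rewrite E mulr_ge0 // subr_ge0 // fg //.
rewrite !fctE; ring.
Qed.

Lemma derive_eq_increment (R : realType) (f g f' : R -> R) (a b : R) :
  (forall t : R, is_derive t 1 f (f' t)) ->
  (forall t : R, is_derive t 1 g (f' t)) ->
  f b - f a = g b - g a.
Proof.
move=> df dg; wlog ab : a b / a <= b.
  move=> H; case: (leP a b) => [|/ltW] ab; first exact: H.
  by apply: oppr_inj; rewrite !opprB; exact: H.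
by apply/le_anti; rewrite !(derive_le_increment (f' := f') (g' := f')).
Qed.

Lemma is_derive_mull (R : realType) (c u : R) :
  is_derive u 1 (fun u : R => c * u) c.
Proof.
have := @is_deriveZ R R R id c u 1 _ (is_derive_id _ _).
by rewrite regular_scaleE mulr1.
Qed.

(** The function [E s * expR (- C * s)] is nonincreasing and
[E s * expR (C * s)] is nondecreasing; the first gives the bound for [t >= 0],
the second for [t < 0]. *)
Lemma gronwall_scalar (R : realType) (E E' : R -> R) (C : R) :
  (forall t : R, is_derive t 1 E (E' t)) -> (forall t, `|E' t| <= C * E t) ->
  forall t, E t <= E 0 * expR (C * `|t|).
Proof.
move=> dE E'C t.
have dexp c (s : R) : is_derive s 1 (fun s => expR (c * s)) (c * expR (c * s)).
  have := is_derive1_comp (is_derive_expR (c * s)) (is_derive_mull c s).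
  by rewrite mulrC.
have dF c (s : R) : is_derive s 1 (fun s => E s * expR (c * s))
    ((E' s + c * E s) * expR (c * s)).
  apply: is_derive_eq (is_deriveM (dE s) (dexp c s)) _.
  by rewrite !regular_scaleE; ring.
have d0 (s : R) : is_derive s 1 (fun _ : R => 0 : R) 0 := is_derive_cst _ _ _.
have EC s : - (C * E s) <= E' s <= C * E s by rewrite -ler_norml.
case: (leP 0 t) => t0.
- have := @derive_le_increment _ _ _ _ _ 0 t (dF (- C)) d0 t0.
  rewrite subrr subr_le0 mulr0 expR0 mulr1.
  move=> H; rewrite -(ler_pM2r (expR_gt0 (- C * t))).
  rewrite (le_trans (H _)) //.
    move=> s _; rewrite mulr_le0_ge0 ?expR_ge0 // mulNr subr_le0.
    by case/andP: (EC s).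
  by rewrite ger0_norm // -mulrA -expRD mulNr subrr expR0 mulr1.
- have := @derive_le_increment _ _ _ _ _ t 0 d0 (dF C) (ltW t0).
  rewrite subrr subr_ge0 mulr0 expR0 mulr1.
  move=> H; rewrite -(ler_pM2r (expR_gt0 (C * t))).
  rewrite (le_trans (H _)) //.
    move=> s _; rewrite mulr_ge0 ?expR_ge0 // -lerBlDr sub0r.
    by case/andP: (EC s).
  by rewrite ltr0_norm // -mulrA -expRD mulrN addNr expR0 mulr1.
Qed.

(** The norm on row vectors is the maximum norm, which is not differentiable, so
the differential inequality is written for the squared Euclidean distance [E];
the dimension enters through the comparison of the two norms.  The field [F] may
depend on time, as the change of clock requires. *)
Lemma gronwall (R : realType) (d : nat) (F : R -> 'rV[R]_d -> 'rV[R]_d)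
    (K : R) (u w : R -> 'rV[R]_d) :
  0 <= K -> (forall t x y, `|F t x - F t y| <= K * `|x - y|) ->
  (forall t : R, is_derive t 1 u (F t (u t))) ->
  (forall t : R, is_derive t 1 w (F t (w t))) ->
  forall t, `|u t - w t| ^+ 2 <=
    d%:R * expR (2 * d%:R * K * `|t|) * `|u 0 - w 0| ^+ 2.
Proof.
move=> K0 FK du dw t.
pose E := \sum_(i < d) (fun s => (u s 0 i - w s 0 i) ^+ 2).
pose E' s := \sum_(i < d)
  2 * (u s 0 i - w s 0 i) * (F s (u s) 0 i - F s (w s) 0 i).
have EE s : E s = \sum_(i < d) (u s 0 i - w s 0 i) ^+ 2.
  by rewrite /E fct_sumE.
have dE (s : R) : is_derive s 1 E (E' s).
  apply: is_derive_sum => i.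
  have dui := is_derive_coord i (du s); have dwi := is_derive_coord i (dw s).
  apply: is_derive_eq (is_deriveX 2 (is_deriveB dui dwi)) _.
  by rewrite /= expr1 regular_scaleE mulr_natl.
have norm_le_E s : `|u s - w s| ^+ 2 <= E s.
  rewrite -ler_sqrt ?EE ?sumr_ge0 // => [|i _]; last exact: sqr_ge0.
  rewrite sqrtr_sqr ger0_norm //; apply: rV_norm_le; first exact: sqrtr_ge0.
  move=> i; rewrite -sqrtr_sqr ler_sqrt; last first.
    by rewrite sumr_ge0 // => j _; exact: sqr_ge0.
  rewrite !mxE (bigD1 i) //= lerDl sumr_ge0 // => j _; exact: sqr_ge0.
have E_le_norm s : E s <= d%:R * `|u s - w s| ^+ 2.
  rewrite EE -[d in d%:R]card_ord mulr_natl -sumr_const ler_sum // => i _.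
  rewrite -real_normK ?num_real // lerXn2r ?nnegrE //.
  by have := rV_norm_coord (u s - w s) i; rewrite !mxE.
have E'le s : `|E' s| <= (2 * d%:R * K) * E s.
  rewrite (le_trans (ler_norm_sum _ _ _)) //.
  rewrite (@le_trans _ _ (\sum_(i < d) 2 * K * `|u s - w s| ^+ 2)) //.
    apply: ler_sum => i _; rewrite !normrM ger0_norm // -mulrA -mulrA.
    rewrite ler_wpM2l // mulrC expr2 mulrA ler_pM //.
      have := rV_norm_coord (F s (u s) - F s (w s)) i; rewrite !mxE => /le_trans.
      exact.
    by have := rV_norm_coord (u s - w s) i; rewrite !mxE.
  rewrite sumr_const card_ord -[_ *+ d]mulr_natl !mulrA [d%:R * 2]mulrC.
  by rewrite -mulrA -expr2 ler_wpM2l // !mulr_ge0.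
rewrite (le_trans (norm_le_E t)) // (le_trans (gronwall_scalar dE E'le t)) //.
by rewrite [leRHS]mulrAC ler_wpM2r ?expR_ge0.
Qed.

Lemma ode_unique (R : realType) (d : nat) (F : R -> 'rV[R]_d -> 'rV[R]_d)
    (K : R) (u w : R -> 'rV[R]_d) :
  0 <= K -> (forall t x y, `|F t x - F t y| <= K * `|x - y|) ->
  (forall t : R, is_derive t 1 u (F t (u t))) ->
  (forall t : R, is_derive t 1 w (F t (w t))) ->
  u 0 = w 0 -> u = w.
Proof.
move=> K0 FK du dw uw0; apply/funext => t.
have := gronwall K0 FK du dw t.
rewrite uw0 subrr normr0 expr0n mulr0 => H.
apply: subr0_eq; apply: normr0_eq0; apply/eqP; rewrite -sqrf_eq0.
by apply/eqP/le_anti; rewrite H sqr_ge0.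
Qed.

Lemma is_derive_row (R : realType) (d : nat) (V : normedModType R)
    (u : V -> 'rV[R]_d) (t v : V) (u' : 'rV[R]_d) :
  (forall i, is_derive t v (fun s => u s 0 i) (u' 0 i)) -> is_derive t v u u'.
Proof.
move=> du.
have ud : derivable u t v.
  by apply/derivable_mxP => i j; rewrite ord1; case: (du j).
by split=> //; apply/rowP => i; rewrite derive_mx // mxE; case: (du i).
Qed.

Lemma is_derive_reparam (R : realType) (d : nat) (u : R -> 'rV[R]_d)
    (T : R -> R) (t T' : R) (u' : 'rV[R]_d) :
  is_derive (T t) 1 u u' -> is_derive t 1 T T' ->
  is_derive t 1 (u \o T) (T' *: u').
Proof.
move=> du dT; apply: is_derive_row => i; rewrite mxE mulrC.
exact: (@is_derive1_comp _ (fun s => u s 0 i)) (is_derive_coord i du) dT.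
Qed.

Section flow.
Variables (R : realType) (d : nat) (b : 'rV[R]_d -> 'rV[R]_d) (K : R).
Variable X : R -> 'rV[R]_d -> 'rV[R]_d.
Hypothesis K0 : 0 <= K.
Hypothesis bK : forall x y, `|b x - b y| <= K * `|x - y|.
Hypothesis Xflow : is_flow b X.

Lemma flow_lipschitz t :
  exists2 L, 0 < L & forall x y, `|X t x - X t y| <= L * `|x - y|.
Proof.
set c := d%:R * expR (2 * d%:R * K * `|t|).
have c0 : 0 <= c by rewrite mulr_ge0 ?expR_ge0.
exists (1 + c); first by rewrite ltr_pwDl.
move=> x y; have := @gronwall _ _ (fun _ => b) K (X ^~ x) (X ^~ y) K0
  (fun _ => bK) (Xflow x).2 (Xflow y).2 t.
rewrite (Xflow x).1 (Xflow y).1 -/c => H.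
have L0 : 0 <= (1 + c) * `|x - y| by rewrite mulr_ge0 // addr_ge0.
rewrite -(@ler_pXn2r _ 2) // ?nnegrE // (le_trans H) // exprMn.
rewrite ler_wpM2r ?sqr_ge0 //; nra.
Qed.

Lemma flow_continuous t : continuous (X t).
Proof.
have [L L0 HL] := flow_lipschitz t.
move=> x; apply/(@cvgrPdist_le _ _ _ _ (nbhs_filter x)) => /= e e0; near=> y.
rewrite (le_trans (HL _ _)) // mulrC -ler_pdivlMr //.
near: y; apply: cvgr_dist_le; [exact: cvg_id | exact: divr_gt0].
Unshelve. all: by end_near. Qed.

(** Both sides solve the equation of [b], which is invariant under integer
translations, with the same initial value. *)
Lemma flow_periodic t x k : Defs.periodic b -> k \is a mxOver Num.int ->
  X t (x + k) = X t x + k.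
Proof.
move=> pb kZ.
suff : X ^~ (x + k) = (fun s => X s x + k) by move/(congr1 (@^~ t)).
apply: (@ode_unique _ _ (fun _ => b) K) => //.
- by move=> s; case: (Xflow (x + k)) => _; exact.
- move=> s; rewrite pb //.
  apply: is_derive_eq (is_deriveD ((Xflow x).2 s) (is_derive_cst k _ _)) _.
  by rewrite addr0.
- by rewrite !(Xflow _).1.
Qed.

Lemma flow_add s t x : X s (X t x) = X (s + t) x.
Proof.
suff : X ^~ (X t x) = (fun r => X (r + t) x) by move/(congr1 (@^~ s)).
apply: (@ode_unique _ _ (fun _ => b) K) => //.
- by move=> r; case: (Xflow (X t x)) => _; exact.
- move=> r; have [_ /(_ (r + t))] := Xflow x.
  move=> H; rewrite -[b _]scale1r.
  exact: (@is_derive_reparam _ _ (X ^~ x) (shift t)) H (is_derive_shift _ _ _).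
- by rewrite (Xflow _).1 add0r.
Qed.

End flow.

(** * Primitives of continuous functions *)

Section primitive.
Variables (R : realType) (g : R -> R).
Hypothesis cg : continuous g.
Notation mu := (@lebesgue_measure R).

Lemma continuous_integrable_itv (a b : R) : mu.-integrable `[a, b] (EFin \o g).
Proof.
apply: continuous_compact_integrable; first exact: segment_compact.
exact: continuous_subspaceT.
Qed.

Lemma Rintegral_itv_split (a x b : R) : a <= x <= b ->
  \int[mu]_(s in `[a, b]) g s - \int[mu]_(s in `[a, x]) g s =
  \int[mu]_(s in `[x, b]) g s.
Proof.
move=> /andP[ax xb].
rewrite (Rintegral_itvB (continuous_integrable_itv a b)) ?bnd_simp //.
rewrite Rintegral_itv_obnd_cbnd //.
apply: integrableS (continuous_integrable_itv x b) => //.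
exact: subset_itv_oc_cc.
Qed.

(** The integral from 0 to [t], signed: one of the two integrals is over an empty
interval or over a single point. *)
Definition primitive (t : R) : R :=
  \int[mu]_(s in `[0, t]) g s - \int[mu]_(s in `[t, 0]) g s.

Lemma primitive0 : primitive 0 = 0.
Proof. exact: subrr. Qed.

(** Seen from a base point [a] to the left of both 0 and [t], the primitive is a
difference of integrals over intervals issued from [a], to which the fundamental
theorem of calculus applies. *)
Lemma primitiveE (a t : R) : a <= t -> a <= 0 ->
  primitive t = \int[mu]_(s in `[a, t]) g s - \int[mu]_(s in `[a, 0]) g s.
Proof.
move=> at_ a0; rewrite /primitive.
have null (x y : R) : y <= x -> \int[mu]_(s in `[x, y]) g s = 0.
  rewrite le_eqVlt => /predU1P[->|yx]; first by rewrite set_itv1 Rintegral_set1.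
  by rewrite set_itv_ge ?Rintegral_set0 // bnd_simp -ltNge.
case: (leP 0 t) => [t0|/ltW t0].
- by rewrite (null t) // subr0 (Rintegral_itv_split (x := 0)) ?a0 ?t0.
- rewrite (null 0) // sub0r -opprB (Rintegral_itv_split (x := t)) //.
  by rewrite at_ t0.
Qed.

Lemma is_derive_primitive (t : R) : is_derive t 1 primitive (g t).
Proof.
pose a := Num.min t 0 - 1.
have mt : Num.min t 0 <= t by rewrite ge_min lexx.
have m0 : Num.min t 0 <= 0 by rewrite ge_min lexx orbT.
have at_ : a < t by rewrite ltrBlDr (le_lt_trans mt) // ltrDl.
have a0 : a <= 0 by rewrite /a; lra.
pose F x := \int[mu]_(s in `[a, x]) g s.
have t1 : t < t + 1 by rewrite ltrDl.
have [dF F'] : derivable F t 1 /\ derive1 F t = g t.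
  apply: (continuous_FTC1_closed t1 (continuous_integrable_itv a _) at_).
  exact: cg.
have dFt : is_derive t 1 F (g t) by split=> //; rewrite -derive1E.
have := is_deriveB dFt (is_derive_cst (F 0) t 1); rewrite subr0.
apply: near_eq_is_derive.
near=> s.
have as_ : a <= s by apply: ltW; near: s; exact: lt_nbhsr.
by rewrite (primitiveE as_ a0).
Unshelve. all: by end_near. Qed.

End primitive.

(** * The Riesz representation theorem on a compact space *)

Section riesz.
Variables (R : realType) (T : ptopologicalType) (L : (T -> R) -> R).
Hypothesis Tcompact : compact [set: T].
Hypothesis open_cozero : forall U : set T, open U ->
  exists2 g : T -> R, continuous g &
    (forall x, 0 <= g x) /\ U = [set x | 0 < g x].
Hypothesis L_lin : forall (a : R) (f g : T -> R),
  continuous f -> continuous g ->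
  L (fun x => a * f x + g x) = a * L f + L g.
Hypothesis L_ge0 : forall f : T -> R, continuous f -> (forall x, 0 <= f x) ->
  0 <= L f.
Hypothesis L_one : L (fun=> 1) = 1.

Lemma functionalD (f g : T -> R) : continuous f -> continuous g ->
  L (fun x => f x + g x) = L f + L g.
Proof.
move=> cf cg; rewrite -[L f]mul1r -L_lin //; congr L.
by apply/funext => x; rewrite mul1r.
Qed.

Lemma functional0 : L (fun=> 0) = 0.
Proof.
have c0 : continuous (fun _ : T => 0 : R) by exact: cst_continuous.
have := functionalD c0 c0; under eq_fun do rewrite addr0.
by move/eqP; rewrite addrC -subr_eq subrr eq_sym => /eqP.
Qed.

Lemma functionalZ (a : R) (f : T -> R) :
  continuous f -> L (fun x => a * f x) = a * L f.
Proof.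
have c0 : continuous (fun _ : T => 0 : R) by exact: cst_continuous.
move=> cf; rewrite -[RHS]addr0 -functional0 -L_lin //; congr L.
by apply/funext => x; rewrite addr0.
Qed.

Lemma functional_cst (a : R) : L (fun=> a) = a.
Proof.
have c1 : continuous (fun _ : T => 1 : R) by exact: cst_continuous.
rewrite -[RHS]mulr1 -L_one -functionalZ //.
by under [in RHS]eq_fun do rewrite mulr1.
Qed.

Lemma functionalB (f g : T -> R) : continuous f -> continuous g ->
  L (fun x => f x - g x) = L f - L g.
Proof.
move=> cf cg; rewrite -mulN1r addrC -L_lin //; congr L.
by apply/funext => x; rewrite mulN1r addrC.
Qed.

Lemma functional_le (f g : T -> R) : continuous f -> continuous g ->
  (forall x, f x <= g x) -> L f <= L g.
Proof.
move=> cf cg fg; rewrite -subr_ge0 -functionalB //; apply: L_ge0.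
  by move=> x; apply: cvgB; [exact: cg|exact: cf].
by move=> x; rewrite subr_ge0.
Qed.

Lemma functional_sum n (f : nat -> T -> R) : (forall k, continuous (f k)) ->
  continuous (fun x => \sum_(k < n) f k x) /\
  L (fun x => \sum_(k < n) f k x) = \sum_(k < n) L (f k).
Proof.
move=> cf; elim: n => [|n [cS IH]].
  under eq_fun do rewrite big_ord0.
  by rewrite big_ord0 functional0; split=> // x; exact: cvg_cst.
under eq_fun do rewrite big_ord_recr /=.
rewrite big_ord_recr /= functionalD // IH; split=> //.
by move=> x; apply: cvgD; [exact: cS|exact: cf].
Qed.

(** [covers A c] says that the indicator function of [A] lies below the supremum of
a nondecreasing sequence of nonnegative continuous functions whose values under
[L] are at most [c].  The infimum of these [c] is the outer measure of [A].
Monotone sequences replace the open neighbourhoods of the usual proof: they can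
be multiplied by a fixed continuous function and added. *)
Definition covers (A : set T) (c : R) : Prop :=
  exists f : nat -> T -> R,
    [/\ forall n, continuous (f n), forall n x, 0 <= f n x,
        forall m n x, (m <= n)%N -> f m x <= f n x,
        forall x, A x -> forall e, 0 < e -> exists n, 1 - e < f n x &
        forall n, L (f n) <= c].

Lemma covers_cst (A : set T) (f : T -> R) : continuous f ->
  (forall x, 0 <= f x) -> (forall x, A x -> 1 <= f x) -> covers A (L f).
Proof.
move=> cf f0 f1; exists (fun=> f); split=> // x Ax e e0; exists 0%N.
by rewrite (lt_le_trans _ (f1 _ Ax)) // ltrBlDr ltrDl.
Qed.

Lemma covers_ge0 A c : covers A c -> 0 <= c.
Proof. by move=> [f [cf f0 _ _ /(_ 0%N)]]; exact/le_trans/L_ge0. Qed.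

Lemma coversS A B c : A `<=` B -> covers B c -> covers A c.
Proof. by move=> AB [f [cf f0 fn fB Lf]]; exists f; split=> // x /AB/fB. Qed.

Lemma covers1 A : covers A 1.
Proof.
by rewrite -L_one; apply: covers_cst => //; exact: cst_continuous.
Qed.

Definition capacity (A : set T) : \bar R := ereal_inf (EFin @` covers A).

Lemma capacity_ge0 A : (0 <= capacity A)%E.
Proof.
by apply: le_ereal_inf_tmp => _ [c /covers_ge0 c0 <-]; rewrite lee_fin.
Qed.

Lemma capacity_le A c : covers A c -> (capacity A <= c%:E)%E.
Proof. by move=> Ac; apply: ereal_inf_lbound; exists c. Qed.

Lemma capacity_fin A : capacity A \is a fin_num.
Proof.
rewrite ge0_fin_numE ?capacity_ge0 //.
by rewrite (le_lt_trans (capacity_le (covers1 A))) // ltry.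
Qed.

Lemma capacity_approx A (e : R) : 0 < e ->
  exists2 c, covers A c & (c%:E < capacity A + e%:E)%E.
Proof.
move=> e0; have [_ [c Ac <-] ce] := lb_ereal_inf_adherent e0 (capacity_fin A).
by exists c.
Qed.

Lemma capacity0 : capacity set0 = 0%E.
Proof.
apply/le_anti; rewrite capacity_ge0 andbT.
have := @capacity_le set0 (L (fun=> 0)); rewrite functional0; apply.
by rewrite -functional0; apply: covers_cst => //; exact: cst_continuous.
Qed.

Lemma le_capacity : {homo capacity : A B / A `<=` B >-> (A <= B)%E}.
Proof.
move=> A B AB; apply: ereal_inf_le_tmp => _ [c Bc <-]; exists c => //.
exact: coversS Bc.
Qed.

(** If [f i] covers [A i], the sums [\sum_(i < n) f i n] cover the union: they are
nondecreasing in [n], and dominate each [f i m] from some rank on. *)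
Lemma capacity_sigma_subadditive : sigma_subadditive capacity.
Proof.
move=> A; have [->|Sfin] := eqVneq (\sum_(i <oo) capacity (A i))%E +oo%E.
  by rewrite leey.
apply/lee_addgt0Pr => e e0.
have eps0 i : 0 < e / (2 ^ i.+1)%:R by rewrite divr_gt0 // ltr0n expn_gt0.
have /choice[c cP] : forall i, exists c,
    covers (A i) c /\ (c%:E < capacity (A i) + (e / (2 ^ i.+1)%:R)%:E)%E.
  by move=> i; have [c] := capacity_approx (A i) (eps0 i); exists c.
have /choice[f fP] i := (cP i).1.
have cf i n : continuous (f i n) by case: (fP i).
have f0 i n x : 0 <= f i n x by case: (fP i).
have fnd i m n x : (m <= n)%N -> f i m x <= f i n x.
  by move=> mn; case: (fP i) => _ _ + _ _; exact.
set s := (\sum_(i <oo) capacity (A i) + e%:E)%E.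
have s_fin : s \is a fin_num.
  rewrite fin_numD andbT ge0_fin_numE ?ltey // nneseries_ge0 // => i _ _.
  exact: capacity_ge0.
rewrite -/s -(fineK s_fin); apply: capacity_le.
exists (fun n x => \sum_(i < n) f i n x); split.
- by move=> n; have [] := functional_sum n (cf ^~ n).
- by move=> n x; exact: sumr_ge0.
- move=> m n x mn; rewrite (big_ord_widen _ (fun i => f i m x) mn).
  rewrite big_mkcond /= ler_sum // => i _.
  by case: ifPn => // _; exact: fnd.
- move=> x [i _ Aix] d d0; have [_ _ _ /(_ x Aix d d0)[n fn] _] := fP i.
  exists (maxn n i.+1); rewrite (bigD1 (Ordinal (leq_maxr n i.+1))) //=.
  rewrite (lt_le_trans fn) // (le_trans (fnd i n (maxn n i.+1) x _)) ?leq_maxl //.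
  by rewrite lerDl sumr_ge0.
- move=> n; have [_ ->] := functional_sum n (cf ^~ n).
  rewrite -lee_fin fineK // -sumEFin.
  have cap0 i : (0 <= capacity (A i) + (e / (2 ^ i.+1)%:R)%:E)%E.
    by rewrite adde_ge0 ?capacity_ge0 // lee_fin ltW.
  apply: (@le_trans _ _
    (\sum_(0 <= i < n) (capacity (A i) + (e / (2 ^ i.+1)%:R)%:E))%E).
    rewrite big_mkord lee_sum // => i _; have [_ /ltW] := cP i.
    by apply: le_trans; rewrite lee_fin; case: (fP i).
  apply: le_trans (epsilon_trick xpredT _ (ltW e0)); last first.
    by move=> i; exact: capacity_ge0.
  by apply: nneseries_lim_ge.
Qed.

HB.instance Definition _ := isOuterMeasure.Build R T capacity
  capacity0 capacity_ge0 le_capacity capacity_sigma_subadditive.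

(** Write the open set as [0 < g] and let [h n] be [n * g] truncated at 1, which
increases to the indicator function of [U].  A sequence [f n] that covers [X]
splits into [f n * h n], which covers [X `&` U], and [f n - f n * h m] for one
fixed large [m], which covers the rest of [X] since [h m] vanishes there; the
costs add up to that of [f n], up to [e]. *)
Lemma capacity_caratheodory_open U : open U -> capacity.-caratheodory U.
Proof.
move=> oU; have [g cg [g0 Ug]] := open_cozero oU.
apply: le_caratheodory_measurable => X; apply/lee_addgt0Pr => e e0.
have e2 : 0 < e / 2 by rewrite divr_gt0.
have [c [f [cf f0 fnd fX Lfc]] cX] := capacity_approx X e2.
pose h n x := Num.min 1 (n%:R * g x).
have h0 n x : 0 <= h n x by rewrite le_min ler01 mulr_ge0.
have h1 n x : h n x <= 1 by rewrite ge_min lexx.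
have ch n : continuous (h n).
  move=> x; apply: (@continuous_min R T (fun=> 1) (fun x => n%:R * g x)).
    exact: cst_continuous.
  apply: cvgM; [exact: cvg_cst|exact: cg].
have hnd m n x : (m <= n)%N -> h m x <= h n x.
  move=> mn; rewrite le_min ge_min lexx /= ge_min orbC.
  by rewrite ler_wpM2r // ler_nat.
have cfh n m : continuous (fun x => f n x * h m x).
  by move=> x; apply: cvgM; [exact: cf|exact: ch].
have cf1h n m : continuous (fun x => f n x - f n x * h m x).
  by move=> x; apply: cvgB; [exact: cf|exact: cfh].
have Lfh_nd n m n' m' : (n <= n')%N -> (m <= m')%N ->
    L (fun x => f n x * h m x) <= L (fun x => f n' x * h m' x).
  move=> nn' mm'; apply: functional_le => // x.
  by rewrite ler_pM //; [exact: fnd|exact: hnd].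
(* The cost of the cover of [X `&` U]. *)
pose c1 := sup (range (fun n => L (fun x => f n x * h n x))).
have c1_sup : has_sup (range (fun n => L (fun x => f n x * h n x))).
  split; first by exists (L (fun x => f 0%N x * h 0%N x)); exists 0%N.
  exists c => _ [n _ <-]; rewrite (le_trans _ (Lfc n)) // functional_le // => x.
  by rewrite ler_piMr.
have coverU : covers (X `&` U) c1.
  exists (fun n x => f n x * h n x); split=> //.
  - by move=> n x; rewrite mulr_ge0.
  - by move=> m n x mn; rewrite ler_pM //; [exact: fnd|exact: hnd].
  - move=> x [Xx]; rewrite Ug /= => gx d d0; have [n fn] := fX x Xx d d0.
    pose m := Num.bound (g x)^-1.
    have hm : h m x = 1.
      apply/min_idPl; rewrite -ler_pdivrMr // div1r ltW //.
      by rewrite archi_boundP // invr_ge0 ltW.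
    exists (maxn n m); rewrite (@lt_le_trans _ _ (f n x * h m x)) ?hm ?mulr1 //.
    rewrite -[leLHS]mulr1 ler_pM //; first exact/fnd/leq_maxl.
    by rewrite -hm; exact/hnd/leq_maxr.
  - by move=> n; apply: sup_upper_bound => //; exists n.
have [_ [m _ <-] c1m] := sup_adherent e2 c1_sup.
have coverC : covers (X `&` ~` U) (c - c1 + e / 2).
  exists (fun n x => f n x - f n x * h m x); split=> //.
  - by move=> n x; rewrite subr_ge0 ler_piMr.
  - move=> k n x kn; rewrite -[X in X - _]mulr1 -[X in _ <= X - _]mulr1 -!mulrBr.
    by rewrite ler_wpM2r ?subr_ge0 //; exact: fnd.
  - move=> x [Xx]; rewrite Ug /= => /negP; rewrite -leNgt => gx d d0.
    have [n fn] := fX x Xx d d0; exists n.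
    have g00 : g x = 0 by apply/le_anti; rewrite gx g0.
    by rewrite /h g00 mulr0 (min_idPr _) // mulr0 subr0.
  - move=> n; apply: (@le_trans _ _
        (L (fun x => f (maxn n m) x - f (maxn n m) x * h m x))).
      apply: functional_le => // x.
      rewrite -[X in X - _]mulr1 -[X in _ <= X - _]mulr1 -!mulrBr.
      by rewrite ler_wpM2r ?subr_ge0 //; exact/fnd/leq_maxl.
    rewrite functionalB // -addrA lerD // lerNl opprD opprK.
    rewrite (le_trans (ltW c1m)) // Lfh_nd //; exact: leq_maxr.
rewrite (le_trans (leeD (capacity_le coverU) (capacity_le coverC))) //.
rewrite -EFinD (_ : c1 + _ = c + e / 2); last by ring.
by rewrite EFinD [e in leRHS]splitr EFinD addeA leeD2r // ltW.
Qed.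

Notation borel := (g_sigma_algebraType (@open T)).

Lemma capacity_borel_caratheodory (A : set borel) :
  measurable A -> capacity.-cara.-measurable A.
Proof.
move=> mA; apply: (smallest_sub _ _ mA); last exact: capacity_caratheodory_open.
exact: (@sigma_algebra_measurable _ (caratheodory_type capacity)).
Qed.

Let mu : set borel -> \bar R := capacity.

Let mu_semi_sigma_additive : semi_sigma_additive mu.
Proof.
move=> F mF tF mUF.
apply: (@caratheodory_measure_sigma_additive R T capacity) => //.
- by move=> i; exact: capacity_borel_caratheodory (mF i).
- exact: capacity_borel_caratheodory mUF.
Qed.

HB.instance Definition _ := isMeasure.Build _ borel R mu
  capacity0 capacity_ge0 mu_semi_sigma_additive.

(** Dini's argument: a sequence that covers the compact space [T] exceeds [1 - e]
everywhere from some rank on, or else a cluster point of points where it fails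
to do so would not be covered. *)
Lemma capacity_setT : capacity [set: T] = 1%E.
Proof.
apply/le_anti; rewrite (capacity_le (covers1 _)) /=.
apply: le_ereal_inf_tmp => _ [c [f [cf f0 fnd fT Lfc]] <-].
rewrite lee_fin; apply/ler_addgt0Pr => e e0.
suff [n fn] : exists n, forall x, 1 - e <= f n x.
  rewrite -lerBlDr (le_trans _ (Lfc n)) // -[leLHS]functional_cst functional_le //.
  exact: cst_continuous.
apply: contrapT => /forallNP nfn.
have /choice[x xP] : forall n, exists x, f n x < 1 - e.
  move=> n; have /existsNP[x /negP] := nfn n.
  by rewrite -ltNge; exists x.
have [|p [_ clp]] := @Tcompact _ (fmap_proper_filter x eventually_filter) _.
  exact: filterT.
have [m fm] := fT p I e e0.
have Vp : nbhs p [set y | 1 - e < f m y].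
  by apply: (cf m p [set r | 1 - e < r]); exact: lt_nbhsr.
have Fx : (x @ \oo) (x @` [set n | (m <= n)%N]).
  by exists m => // n /= mn; exists n.
have [_ [[n /= mn <-] /= fmx]] := clp _ _ Fx Vp.
have := lt_trans (le_lt_trans (fnd m n (x n) mn) (xP n)) fmx.
by rewrite ltxx.
Qed.

HB.instance Definition _ := Measure_isProbability.Build _ borel R mu
  capacity_setT.

Lemma continuous_measurable_borel (f : T -> R) : continuous f ->
  measurable_fun [set: borel] (f : borel -> R).
Proof.
move=> cf; apply: (measurability _ (RGenOpens.measurableE R)).
move=> _ [_ [a [b ->]] <-]; rewrite setTI; apply: sub_sigma_algebra.
by move/continuousP : cf; apply; exact: interval_open.
Qed.

Lemma bounded_integrable_capacity (f : T -> R) (M : R) : continuous f ->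
  (forall x, `|f x| <= M) -> mu.-integrable setT (EFin \o f).
Proof.
move=> cf fM; apply: measurable_bounded_integrable => //.
- by rewrite -ge0_fin_numE //; exact: capacity_fin.
- exact: continuous_measurable_borel.
- exists M; split=> [|r Mr x _ /=]; first exact: num_real.
  by rewrite (le_trans (fM x)) // ltW.
Qed.

(** The next three lemmas cut [0, N] into unit slices: for [0 <= y <= N] they write
[y] as the sum of the lengths of the parts of the slices that lie below [y], and
bound it by the number of slices whose left end is at most [y]. *)
Lemma minr_step (y : R) n : 0 <= y ->
  Num.min y n.+1%:R = Num.min y n%:R + Num.min 1 (Num.max 0 (y - n%:R)).
Proof.
move=> y0; rewrite -natr1; case: (leP y n%:R) => yn.
  have -> : Num.max 0 (y - n%:R) = 0 by apply/max_idPl; rewrite subr_le0.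
  rewrite (min_idPr ler01) addr0; apply/min_idPl; lra.
have -> : Num.max 0 (y - n%:R) = y - n%:R by apply/max_idPr; lra.
by case: (leP y (n%:R + 1)); case: (leP 1 (y - n%:R)); lra.
Qed.

Lemma minr_slices (y : R) n : 0 <= y ->
  \sum_(j < n) Num.min 1 (Num.max 0 (y - j%:R)) = Num.min y n%:R.
Proof.
move=> y0; elim: n => [|n IH]; first by rewrite big_ord0 (min_idPr _).
by rewrite big_ord_recr /= IH minr_step.
Qed.

Lemma minr_levels (y : R) n : 0 <= y ->
  Num.min y n%:R <= \sum_(j < n) (j%:R <= y)%R%:R.
Proof.
move=> y0; elim: n => [|n IH]; first by rewrite big_ord0 ge_min lexx orbT.
rewrite big_ord_recr /= minr_step // lerD //; case: (leP n%:R y) => /= yn.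
  by rewrite ge_min lexx.
by rewrite ge_min (max_idPl _) ?lexx ?orbT // subr_le0 ltW.
Qed.

(** Layer-cake estimate.  The integral of [f] is at most [N^-1] times the sum of the
measures of the level sets [A j = (j <= N * f)].  The slice [k j] of [N * f] is 1
on [A j.+1], so [A j.+1] has measure at most [L (k j)]; the slices add up to
[N * f], and the remaining level set [A 0] contributes at most [N^-1 <= e]. *)
Lemma integral_capacity_le (f : T -> R) : continuous f ->
  (forall x, 0 <= f x <= 1) -> (\int[mu]_x (f x)%:E <= (L f)%:E)%E.
Proof.
move=> cf f01; apply/lee_addgt0Pr => e e0.
(* The number of slices, chosen so that one slice has height at most [e]. *)
pose N := (Num.bound e^-1).+1.
have N0 : 0 < N%:R :> R by rewrite ltr0n.
have Ne : N%:R^-1 <= e.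
  rewrite -[leRHS]invrK lef_pV2 ?posrE ?invr_gt0 // /N -natr1 ler_wpDr //.
  by rewrite ltW // archi_boundP // invr_ge0 ltW.
have f_ge0 x : 0 <= f x by case/andP: (f01 x).
have Nf_ge0 x : 0 <= N%:R * f x by rewrite mulr_ge0.
have NfN x : Num.min (N%:R * f x) N%:R = N%:R * f x.
  by apply/min_idPl; rewrite ler_piMr //; case/andP: (f01 x).
have cNf : continuous (fun x => N%:R * f x).
  by move=> x; apply: cvgM; [exact: cvg_cst|exact: cf].
pose A j : set borel := [set x | j%:R <= N%:R * f x].
have mA j : measurable (A j).
  have := continuous_measurable_borel cNf measurableT (measurable_itv `[j%:R, +oo[).
  rewrite setTI; congr measurable; apply/seteqP.
  by split=> x /=; rewrite in_itv /= andbT.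
pose k j x := Num.min 1 (Num.max 0 (N%:R * f x - j%:R)).
have ck j : continuous (k j).
  have c1 : continuous (fun _ : T => 1 : R) by exact: cst_continuous.
  have c0 : continuous (fun _ : T => 0 : R) by exact: cst_continuous.
  move=> x; apply: (@continuous_min R T (fun=> 1) (fun x => Num.max 0 _)).
    exact: c1.
  apply: (@continuous_max R T (fun=> 0) (fun x => N%:R * f x - j%:R)).
    exact: c0.
  by apply: cvgB; [exact: cNf|exact: cvg_cst].
have k_ge0 j x : 0 <= k j x by rewrite le_min ler01 le_max lexx.
have capA j : (mu (A j.+1) <= (L (k j))%:E)%E.
  apply: capacity_le; apply: covers_cst => // x.
  rewrite /A /= -natr1 => Ax; rewrite le_min lexx le_max /=.
  by rewrite lerBrDr addrC Ax orbT.
apply: (@le_trans _ _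
    (\int[mu]_x (\sum_(j < N) (N%:R^-1)%:E * (\1_(A j) x)%:E))%E).
  apply: ge0_le_integral => //.
  - by move=> x _; rewrite lee_fin.
  - apply/measurable_EFinP. exact: continuous_measurable_borel cf.
  - apply: emeasurable_sum => j; apply: measurable_funeM.
    exact/measurable_EFinP/measurable_indic.
  - move=> x _; rewrite -(eq_bigr _ (fun _ _ => EFinM _ _)) sumEFin lee_fin.
    rewrite -mulr_sumr ler_pdivlMl // -NfN (le_trans (minr_levels _ _)) //.
    rewrite ler_sum // => j _; rewrite indicE.
    have [jf|_] := leP j%:R (N%:R * f x); last exact: ler0n.
    by rewrite mem_set.
rewrite ge0_integral_sum //; last first.
  move=> j; apply: measurable_funeM; exact/measurable_EFinP/measurable_indic.
have intA j : (\int[mu]_x ((N%:R^-1)%:E * (\1_(A j) x)%:E) =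
    (N%:R^-1)%:E * mu (A j))%E.
  rewrite ge0_integralZl_EFin ?integral_indic ?setIT ?invr_ge0 ?(ltW N0) //.
  exact/measurable_EFinP/measurable_indic.
rewrite (eq_bigr _ (fun (j : 'I_N) _ => intA j)).
rewrite big_ord_recl /=.
apply: (@le_trans _ _ ((N%:R^-1)%:E + \sum_(j < N) (N%:R^-1)%:E * (L (k j))%:E)%E).
  rewrite leeD //.
    rewrite -[leRHS]mule1 lee_wpmul2l ?lee_fin ?invr_ge0 ?(ltW N0) //.
    exact: capacity_le (covers1 _).
  rewrite [leRHS]big_ord_recr /= -[leLHS]adde0 leeD //.
    apply: lee_sum => j _; rewrite lee_wpmul2l ?lee_fin ?invr_ge0 ?(ltW N0) //; exact: capA.
  by rewrite mule_ge0 // lee_fin ?invr_ge0 ?(ltW N0) // L_ge0.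
rewrite -(eq_bigr _ (fun _ _ => EFinM _ _)) sumEFin -EFinD lee_fin.
rewrite -mulr_sumr addrC lerD //.
have [_ <-] := functional_sum N ck; rewrite ler_pdivrMl // -functionalZ // functional_le //.
- by have [] := functional_sum N ck.
- by move=> x; rewrite minr_slices // NfN.
Qed.

(** The inequality applied to [f] and to [1 - f] yields the equality. *)
Lemma Rintegral_capacity01 (f : T -> R) : continuous f ->
  (forall x, 0 <= f x <= 1) -> \int[mu]_x f x = L f.
Proof.
move=> cf f01.
have int01 (g : T -> R) : continuous g -> (forall x, 0 <= g x <= 1) ->
    mu.-integrable setT (EFin \o g).
  move=> cg g01; apply: (bounded_integrable_capacity (M := 1)) => // x.
  by case/andP: (g01 x) => ? ?; rewrite ger0_norm.
have c1 : continuous (fun _ : T => 1 : R) by exact: cst_continuous.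
have le_L (g : T -> R) : continuous g -> (forall x, 0 <= g x <= 1) ->
    \int[mu]_x g x <= L g.
  move=> cg g01; rewrite -lee_fin fineK; first exact: integral_capacity_le.
  exact: integrable_fin_num (int01 _ cg g01).
apply/le_anti; rewrite le_L //=.
have cf1 : continuous (fun x => 1 - f x) by move=> x; apply: cvgB; [exact: c1|exact: cf].
have f1_01 x : 0 <= 1 - f x <= 1.
  by rewrite subr_ge0 lerBlDr lerDl andbC; exact: f01.
have int1 : mu.-integrable setT (EFin \o (fun=> 1)).
  by apply: int01 => // x; rewrite ler01 lexx.
have := le_L _ cf1 f1_01; rewrite functionalB // L_one RintegralB //; last exact: int01.
rewrite Rintegral_cst // mul1r.
rewrite (_ : fine _ = 1); last exact: (congr1 fine capacity_setT).
by rewrite lerD2l lerN2.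
Qed.

(** Every continuous function on [T] is an affine image of one with values in
[0, 1]. *)
Theorem riesz_probability : exists P : probability borel R,
  forall f : T -> R, continuous f -> \int[P]_x f x = L f.
Proof.
exists mu => f cf.
have [c _ cM] : exists2 c, c \in [set: T] &
    forall t, t \in [set: T] -> `|f t| <= `|f c|.
  apply: (@compact_EVT_max T R (fun x => `|f x|)) => //.
  - by exists point.
  - apply: continuous_subspaceT => x; apply: continuous_comp; first exact: cf.
    exact: norm_continuous.
pose M := `|f c| + 1.
have M0 : 0 < M by rewrite ltr_wpDl.
have fM x : - M <= f x <= M.
  by rewrite -ler_norml (le_trans (cM x _)) ?in_setT // lerDl.
(* [M] is positive, so that [h] is defined also when [f] vanishes. *)
pose h x := (2 * M)^-1 * (f x + M).
have ch : continuous h.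
  move=> x; apply: cvgM; first exact: cvg_cst.
  by apply: cvgD; [exact: cf|exact: cvg_cst].
have h01 x : 0 <= h x <= 1.
  have /andP[Mf fM'] := fM x; have M2 : 0 < 2 * M by rewrite mulr_gt0.
  by rewrite /h mulr_ge0 ?invr_ge0 ?(ltW M2) ?ler_pdivrMl //; lra.
have fE : f = fun x => 2 * M * h x - M.
  by apply/funext => x; rewrite /h; field; lra.
have c2h : continuous (fun x => 2 * M * h x).
  by move=> x; apply: cvgM; [exact: cvg_cst|exact: ch].
have cM' : continuous (fun _ : T => M) by exact: cst_continuous.
rewrite fE functionalB // functionalZ // functional_cst -Rintegral_capacity01 //.
rewrite RintegralB //.
- rewrite RintegralZl ?Rintegral_cst //.
    by rewrite (_ : fine _ = 1) ?mulr1 //; exact: (congr1 fine capacity_setT).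
  apply: (bounded_integrable_capacity (M := 1)) => // x.
  by case/andP: (h01 x) => ? ?; rewrite ger0_norm.
- apply: (bounded_integrable_capacity (M := 2 * M)) => // x.
  have M2 : 0 <= 2 * M by rewrite mulr_ge0 // ltW.
  case/andP: (h01 x) => ? ?; rewrite ger0_norm; [exact: ler_piMr|exact: mulr_ge0].
- by apply: (bounded_integrable_capacity (M := M)) => // x; rewrite gtr0_norm.
Qed.

End riesz.

(** * The torus *)

Section torus_facts.
Variables (R : realType) (d : nat).
Notation V := 'rV[R]_d.

Lemma torus_projP (x y : V) :
  torus_proj x = torus_proj y <-> x - y \is a mxOver Num.int.
Proof.
split => [/(@eqmodP _ (lattice_eq_rel R d))//|xy].
exact/(@eqmodP _ (lattice_eq_rel R d)).
Qed.

Lemma torus_proj_repr (y : torus R d) : torus_proj (repr y) = y.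
Proof. exact: reprK. Qed.

Lemma torus_proj_continuous : continuous (@torus_proj R d).
Proof. exact: pi_continuous. Qed.

Lemma torus_projD (x k : V) : k \is a mxOver Num.int ->
  torus_proj (x + k) = torus_proj x.
Proof. by move=> kZ; apply/torus_projP; rewrite addrAC subrr add0r. Qed.

Lemma torus_compact : compact [set: torus R d].
Proof.
have -> : [set: torus R d] =
    @torus_proj R d @` [set x : V | forall i, `[0, 1]%classic (x 0 i)].
  apply/seteqP; split=> // y _; have [k kZ Qk] := unit_cube_translate (repr y).
  by exists (repr y + k) => //; rewrite torus_projD // torus_proj_repr.
apply: continuous_compact; last exact: unit_cube_compact.
exact/continuous_subspaceT/torus_proj_continuous.
Qed.

Lemma on_torus_proj (T : Type) (f : V -> T) (x : V) : Defs.periodic f ->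
  on_torus f (torus_proj x) = f x.
Proof.
move=> pf; rewrite /on_torus -[in RHS](pf x (repr (torus_proj x) - x)).
  by rewrite subrKC.
by apply/torus_projP; rewrite torus_proj_repr.
Qed.

Lemma on_torus_continuous (T : topologicalType) (f : V -> T) :
  continuous f -> Defs.periodic f -> continuous (on_torus f).
Proof.
move=> cf pf; apply/(@quotient_continuous V _ T (on_torus f)).
rewrite (_ : _ \o _ = f) //; apply/funext => x; exact: on_torus_proj.
Qed.

Lemma comp_torus_proj_C0_per (g : torus R d -> R) :
  continuous g -> C0_per (g \o @torus_proj R d).
Proof.
move=> cg; split=> [x|x k kZ /=]; last by rewrite torus_projD.
by apply: continuous_comp; [exact: torus_proj_continuous|exact: cg].
Qed.

(** The preimage [W] of [U] in the Euclidean space is open and invariant under integer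
translations, so the distance to its complement is continuous, periodic, and
positive exactly on [W].  When [W] is the whole space that distance is the
infimum of an empty set, so this case is treated apart. *)
Lemma torus_open_cozero (U : set (torus R d)) : open U ->
  exists2 g : torus R d -> R, continuous g &
    (forall y, 0 <= g y) /\ U = [set y | 0 < g y].
Proof.
move=> oU; pose W := @torus_proj R d @^-1` U.
have oW : open W by apply: open_comp oU => x _; exact: torus_proj_continuous.
have [[x0 Wx0]|W_full] := pselect (exists x, ~ W x); last first.
  exists (fun=> 1); first exact: cst_continuous.
  split=> //; apply/seteqP; split=> [y _|y _] /=; first exact: ltr01.
  rewrite -[y]torus_proj_repr; apply: contrapT => nU.
  by apply: W_full; exists (repr y).
pose S x := [set `|x - z| | z in ~` W].
have S_inf x : has_inf (S x).
  by split; [exists `|x - x0|; exists x0|exists 0 => _ [z _ <-]].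
pose D x := inf (S x).
have D_ge0 x : 0 <= D x.
  by apply: lb_le_inf; [case: (S_inf x)|move=> _ [z _ <-]].
have D_le x z : ~ W z -> D x <= `|x - z|.
  by move=> Wz; apply: ge_inf; [case: (S_inf x)|exists z].
have D_lip x y : D x <= `|x - y| + D y.
  rewrite -lerBlDl; apply: lb_le_inf; first by case: (S_inf y).
  move=> _ [z Wz <-]; rewrite lerBlDl (le_trans (D_le x z Wz)) //.
  by rewrite -[x - z](subrKA y) ler_normD.
have cD : continuous D.
  move=> x; apply/(@cvgrPdist_le _ _ _ _ (nbhs_filter x)) => /= e e0; near=> y.
  have xy : `|x - y| <= e by near: y; apply: cvgr_dist_le => //; exact: cvg_id.
  rewrite ler_norml; apply/andP; split.
    by have := D_lip y x; rewrite distrC; lra.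
  by have := D_lip x y; lra.
have pD : Defs.periodic D.
  move=> x k kZ.
  have NkZ : - k \is a mxOver Num.int.
    by apply/mxOverP => i j; rewrite mxE rpredN; move/mxOverP : kZ; exact.
  congr inf; apply/seteqP; split=> _ [z Wz <-].
    exists (z - k); first by rewrite /W /= torus_projD.
    by rewrite opprB addrA.
  exists (z + k); first by rewrite /W /= torus_projD.
  by rewrite opprD addrACA subrr addr0.
exists (on_torus D); first exact: on_torus_continuous.
split=> [y|]; first exact: D_ge0.
apply/seteqP; split=> y /=; rewrite -{1}[y]torus_proj_repr.
  move=> Uy; have /nbhs_ballP[e /= e0 eW] : nbhs (repr y) W.
    exact: open_nbhs_nbhs.
  apply: (lt_le_trans e0); apply: lb_le_inf; first by case: (S_inf (repr y)).
  move=> _ [z Wz <-]; rewrite leNgt; apply/negP => ze; apply: Wz; apply: eW.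
  by rewrite -ball_normE.
rewrite on_torus_proj // => Dy; apply: contrapT => nU.
have /(D_le (repr y)) : ~ W (repr y) by rewrite /W /= torus_proj_repr.
by rewrite subrr normr0 leNgt Dy.
Unshelve. all: by end_near. Qed.

(** A continuous function attains its minimum on the compact orbit closure, and the
minimum is not 0 by hypothesis. *)
Lemma orbit_closure_lower_bound (X : R -> V -> V) (x : V) (rho : V -> R) :
  continuous rho -> Defs.periodic rho -> (forall x, 0 <= rho x) ->
  orbit_closure X x `&` zero_set rho = set0 ->
  exists2 c, 0 < c & forall t, c <= rho (X t x).
Proof.
move=> crho prho rho0 F0.
have F_in t : orbit_closure X x (torus_proj (X t x)).
  by apply: subset_closure; exists (X t x) => //; exists t.
have [y Fy ymin] : exists2 c, c \in orbit_closure X x &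
    forall t, t \in orbit_closure X x -> on_torus rho c <= on_torus rho t.
  apply: compact_EVT_min.
  - by exists (torus_proj (X 0 x)).
  - apply: (subclosed_compact _ torus_compact) => //; exact: closed_closure.
  - exact/continuous_subspaceT/on_torus_continuous.
exists (on_torus rho y).
  rewrite lt_neqAle rho0 andbT eq_sym; apply/eqP => y0.
  suff : set0 y by []. by rewrite -F0; split=> //; rewrite inE in Fy.
by move=> t; rewrite -(on_torus_proj (X t x) prho) ymin // inE.
Qed.

(** Continuous functions on the torus correspond to continuous periodic functions, so
a functional on the latter is a functional on the former. *)
Lemma torus_riesz (L : (V -> R) -> R) :
  (forall (a : R) (f g : V -> R), C0_per f -> C0_per g ->
    L (fun x => a * f x + g x) = a * L f + L g) ->
  (forall f : V -> R, C0_per f -> (forall x, 0 <= f x) -> 0 <= L f) ->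
  L (fun=> 1) = 1 ->
  exists P : probability (borel_torus R d) R,
    forall f, C0_per f -> \int[P]_y on_torus f y = L f.
Proof.
move=> L_lin L_ge0 L1.
pose L' (g : torus R d -> R) := L (g \o @torus_proj R d).
have [||P HP] := @riesz_probability R (torus R d) L' torus_compact
  torus_open_cozero _ _ L1.
- by move=> a f g cf cg; apply: L_lin; exact: comp_torus_proj_C0_per.
- move=> f cf f0; apply: L_ge0; first exact: comp_torus_proj_C0_per.
  by move=> x; exact: f0.
exists P => f [cf pf]; rewrite HP; last exact: on_torus_continuous.
by congr L; apply/funext => x; exact: on_torus_proj.
Qed.

End torus_facts.

(** * Limits along ultrafilters and invariant measures *)

(** A set or its complement has its preimage in [F], so a filter finer than the image
cannot contain more sets. *)
Lemma fmap_ultra (T U : Type) (f : T -> U) (F : set_system T) :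
  UltraFilter F -> UltraFilter (f @ F).
Proof.
move=> FU; split=> [|G GF FG]; first exact: fmap_proper_filter.
apply/seteqP; split; last exact: FG.
move=> B GB; have [//|FC] := in_ultra_setVsetC (f @^-1` B) FU.
have GC : G (~` B) by apply: FG.
by have /filter_ex[u []] : G (B `&` ~` B) by exact: filterI.
Qed.

Lemma ultra_bounded_cvg (R : realType) (T : Type) (U : set_system T) (f : T -> R)
    (M : R) : UltraFilter U -> (\forall t \near U, `|f t| <= M) ->
  exists l : R, f @ U --> l.
Proof.
move=> UU fM; have := @segment_compact R (- M) M; rewrite compact_ultra.
move=> /(_ (f @ U) (fmap_ultra f UU)); case=> [|l [_ fl]]; last by exists l.
by apply: filterS fM => t /=; rewrite in_itv /= ler_norml.
Qed.

Lemma primitive_lipschitz (R : realType) (g : R -> R) (M : R) :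
  continuous g -> (forall s, `|g s| <= M) ->
  forall s t, `|primitive g s - primitive g t| <= M * `|s - t|.
Proof.
move=> cg gM s t; wlog st : s t / t <= s.
  move=> H; case: (leP t s) => [|/ltW] st; first exact: H.
  by rewrite distrC [`|s - t|]distrC; exact: H.
rewrite [`|s - t|]ger0_norm ?subr_ge0 // ler_norml; apply/andP; split.
- have := derive_le_increment (is_derive_mull (- M)) (is_derive_primitive cg) st.
  rewrite -mulrBr mulNr; apply => u _.
  by have := gM u; rewrite ler_norml => /andP[].
- have := derive_le_increment (is_derive_primitive cg) (is_derive_mull M) st.
  rewrite -mulrBr; apply => u _.
  by have := gM u; rewrite ler_norml => /andP[].
Qed.

Lemma primitive_ge0 (R : realType) (g : R -> R) (t : R) :
  continuous g -> (forall s, 0 <= g s) -> 0 <= t -> 0 <= primitive g t.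
Proof.
move=> cg g0 t0.
have d0 (s : R) : is_derive s 1 (fun _ : R => 0 : R) 0 := is_derive_cst _ _ _.
have := derive_le_increment d0 (is_derive_primitive cg) t0.
by rewrite subrr primitive0 subr0; apply.
Qed.

Lemma primitive_unique (R : realType) (g G : R -> R) (t : R) :
  continuous g -> (forall s : R, is_derive s 1 G (g s)) ->
  primitive g t = G t - G 0.
Proof.
move=> cg dG; have := derive_eq_increment 0 t (is_derive_primitive cg) dG.
by rewrite primitive0 subr0.
Qed.

Lemma primitive_linear (R : realType) (a : R) (f g : R -> R) (t : R) :
  continuous f -> continuous g ->
  primitive (fun s => a * f s + g s) t = a * primitive f t + primitive g t.
Proof.
move=> cf cg.
have cfg : continuous (fun s => a * f s + g s).
  move=> s; apply: cvgD; last exact: cg.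
  by apply: cvgM; [exact: cvg_cst|exact: cf].
have dG (s : R) : is_derive s 1 (fun t => a * primitive f t + primitive g t)
    (a * f s + g s).
  have df := is_derive_primitive cf s; have dg := is_derive_primitive cg s.
  exact: is_deriveD (is_deriveZ a df) dg.
by rewrite (primitive_unique t cfg dG) !primitive0 mulr0 addr0 subr0.
Qed.

Section krylov_bogoliubov.
Variables (R : realType) (d : nat) (b : 'rV[R]_d -> 'rV[R]_d) (K : R).
Variables (X : R -> 'rV[R]_d -> 'rV[R]_d) (x : 'rV[R]_d).
Hypothesis K0 : 0 <= K.
Hypothesis bK : forall x y, `|b x - b y| <= K * `|x - y|.
Hypothesis pb : Defs.periodic b.
Hypothesis cb : continuous b.
Hypothesis Xflow : is_flow b X.

Definition time_mean (f : 'rV[R]_d -> R) (t : R) : R :=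
  t^-1 * primitive (fun s => f (X s x)) t.

Lemma orbit_continuous : continuous (X ^~ x).
Proof. by move=> t; exact: is_derive_continuous ((Xflow x).2 t). Qed.

Lemma along_orbit_continuous (f : 'rV[R]_d -> R) :
  continuous f -> continuous (fun s => f (X s x)).
Proof.
by move=> cf s; apply: continuous_comp; [exact: orbit_continuous|exact: cf].
Qed.

Lemma time_mean_bounded f : C0_per f ->
  exists M, forall t, 0 < t -> `|time_mean f t| <= M.
Proof.
move=> [cf pf]; have [M M0 fM] := periodic_bounded cf pf; exists M => t t0.
rewrite /time_mean normrM normfV (gtr0_norm t0) ler_pdivrMl // mulrC.
have := primitive_lipschitz (along_orbit_continuous cf) (fun s => fM (X s x)) t 0.
by rewrite primitive0 !subr0 (gtr0_norm t0).
Qed.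

(** The equation of the flow, integrated. *)
Lemma time_mean_coord i t :
  time_mean (fun y => b y 0 i) t = (t^-1 *: (X t x - x)) 0 i.
Proof.
have cbi : continuous (fun y => b y 0 i).
  by move=> y; apply: (continuous_comp (g := fun y : 'rV_d => y 0 i));
    [exact: cb|exact: coord_continuous].
have dXi (s : R) := is_derive_coord i ((Xflow x).2 s).
rewrite /time_mean (primitive_unique t (along_orbit_continuous cbi) dXi).
by rewrite !mxE (Xflow x).1.
Qed.

(** The averages of [f] over [0, t] and over [s, t + s] differ only by the integrals
over two intervals of length [`|s|]. *)
Lemma time_mean_flow f s : C0_per f ->
  exists M, forall t, 0 < t ->
    `|time_mean (f \o X s) t - time_mean f t| <= M * t^-1.
Proof.
move=> [cf pf]; have [M M0 fM] := periodic_bounded cf pf.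
pose P := primitive (fun r => f (X r x)).
have cfX := along_orbit_continuous cf.
have dP := is_derive_primitive cfX.
exists (M * `|s| + M * `|s|) => t t0.
have -> : time_mean (f \o X s) t = t^-1 * (P (t + s) - P s).
  rewrite /time_mean; congr (_ * _).
  have cfXs : continuous (fun r => (f \o X s) (X r x)).
    apply: along_orbit_continuous => y.
    by apply: continuous_comp; [exact: (flow_continuous K0 bK Xflow)|exact: cf].
  have dPs (r : R) : is_derive r 1 (fun r => P (r + s)) ((f \o X s) (X r x)).
    rewrite /= (flow_add K0 bK Xflow) addrC -[f _]mulr1.
    exact: (@is_derive1_comp _ P (shift s)) (dP (r + s)) (is_derive_shift _ _ _).
  by rewrite (primitive_unique t cfXs dPs) add0r.
rewrite /time_mean -/(P t) -mulrBr normrM mulrC normfV (gtr0_norm t0).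
rewrite ler_wpM2r ?invr_ge0 ?(ltW t0) //.
have -> : P (t + s) - P s - P t = (P (t + s) - P t) - (P s - P 0).
  by rewrite /P primitive0; ring.
rewrite (le_trans (ler_normB _ _)) // lerD //.
- have := primitive_lipschitz cfX (fun s => fM (X s x)) (t + s) t.
  by rewrite [t + s]addrC addrK.
- have := primitive_lipschitz cfX (fun s => fM (X s x)) s 0.
  by rewrite subr0.
Qed.

Lemma C0_per_flow f s : C0_per f -> C0_per (f \o X s).
Proof.
move=> [cf pf]; split.
  move=> y; apply: continuous_comp; last exact: cf.
  exact: (flow_continuous K0 bK Xflow).
by move=> y k kZ /=; rewrite (flow_periodic K0 bK Xflow) // pf.
Qed.

(** Krylov-Bogoliubov: the limits of the time averages along [U] define a positive
linear functional, invariant under the flow. *)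
Lemma ultra_mean_measure (U : set_system R) : UltraFilter U -> pinfty_nbhs R `<=` U ->
  exists2 mu, invariant_probability b mu &
    forall f, C0_per f -> time_mean f @ U --> \int[mu]_y on_torus f y.
Proof.
move=> UU infU.
have U_gt (r : R) : U [set t | r < t] by apply: infU; apply: nbhs_pinfty_gt; exact: num_real.
pose L f := lim (time_mean f @ U).
have L_cvg f : C0_per f -> time_mean f @ U --> L f.
  move=> Cf; have [M HM] := time_mean_bounded Cf.
  have [|l Hl] := @ultra_bounded_cvg R R U (time_mean f) M UU.
    by apply: filterS (U_gt 0) => t; exact: HM.
  by rewrite /L (cvg_lim _ Hl).
have L_eq f l : time_mean f @ U --> l -> L f = l by move=> Hl; exact: cvg_lim.
have [|||mu Hmu] := @torus_riesz R d L.
- move=> a f g Cf Cg; apply: L_eq.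
  have -> : time_mean (fun x => a * f x + g x) =
      fun t => a * time_mean f t + time_mean g t.
    case: Cf Cg => [cf _] [cg _]; apply/funext => t; rewrite /time_mean.
    rewrite (primitive_linear _ _ (along_orbit_continuous cf)
      (along_orbit_continuous cg)).
    by rewrite mulrDr mulrCA.
  apply: cvgD; last exact: L_cvg.
  by apply: cvgM; [exact: cvg_cst|exact: L_cvg].
- move=> f Cf f0; apply: (limr_ge (cvgP _ (L_cvg f Cf))).
  apply: filterS (U_gt 0) => t t0; rewrite mulr_ge0 ?invr_ge0 ?(ltW t0) //.
  case: Cf => cf _; apply: primitive_ge0; rewrite ?(ltW t0) //.
  exact: along_orbit_continuous.
- apply: L_eq; apply: cvg_near_cst; apply: filterS (U_gt 0) => t t0.
  have c1 : continuous (fun _ : R => 1 : R) by exact: cst_continuous.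
  have did (s : R) := @is_derive_id R R s 1.
  by rewrite /time_mean (primitive_unique t c1 did) subr0 mulVf ?gt_eqF.
exists mu.
  exists X => // s f Cf.
  rewrite (Hmu _ Cf) (Hmu _ (C0_per_flow s Cf)).
  have [M HM] := time_mean_flow s Cf.
  apply: L_eq.
  apply/cvgrPdist_le => e e0; near=> t.
  have t0 : 0 < t by near: t; exact: U_gt.
  have Lft : `|L f - time_mean f t| <= e / 2.
    near: t; apply: cvgr_dist_le; first exact: L_cvg.
    by rewrite divr_gt0.
  have Mt : M * t^-1 <= e / 2.
    have tM : 2 * M / e < t by near: t; exact: U_gt.
    rewrite ler_pdivrMr // mulrAC ler_pdivlMr // mulrC.
    by move: tM; rewrite ltr_pdivrMr // mulrC [t * e]mulrC => /ltW.
  rewrite (@le_trans _ _ (`|L f - time_mean f t| +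
      `|time_mean (f \o X s) t - time_mean f t|)) //.
    rewrite distrC [`|L f - _|]distrC -[X in `|X|](subrKA (time_mean f t)).
    by rewrite [leRHS]addrC ler_normD.
  by rewrite [e]splitr lerD // (le_trans (HM t t0)).
by move=> f Cf; rewrite Hmu //; exact: L_cvg.
Unshelve. all: by end_near. Qed.

(** If the convergence failed, some ultrafilter finer than [t --> +oo] would contain
the set [B] of times at which [t^-1 *: X t x] is far from [zeta]; but along this
ultrafilter [t^-1 *: (X t x - x)] tends to the integral of [b] for an invariant
probability measure, which is [zeta]. *)
Lemma rotation_singleton_cvg (zeta : 'rV[R]_d) :
  rotation_set b = [set zeta] -> t^-1 *: X t x @[t --> +oo] --> zeta.
Proof.
move=> rot; apply/cvgrPdist_le => e e0; apply: contrapT => not_near.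
pose B := [set t | ~ `|zeta - t^-1 *: X t x| <= e].
have BF : ProperFilter (within B (pinfty_nbhs R)).
  apply: Build_ProperFilter => BF0; apply: not_near.
  have : \forall t \near +oo, B t -> set0 t by exact: BF0.
  by apply: filterS => t Bt; exact: contrapT.
have [U [UU BU]] := ultraFilterLemma BF.
have infU : pinfty_nbhs R `<=` U.
  by move=> P FP; apply: BU; apply: filterS FP => t Pt _.
have UB : U B by apply: BU; exact: withinT.
have U_gt (r : R) : U [set t | r < t].
  by apply: infU; apply: nbhs_pinfty_gt; exact: num_real.
have [mu mu_inv mu_lim] := ultra_mean_measure UU infU.
have zetaE : vector_integral mu b = zeta.
  have : rotation_set b (vector_integral mu b) by exists mu.
  by rewrite rot.
have Cb i : C0_per (fun y => b y 0 i).
  split=> [y|y k kZ]; last by rewrite pb.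
  by apply: (continuous_comp (g := fun y : 'rV_d => y 0 i));
    [exact: cb|exact: coord_continuous].
have near_coord : \forall t \near U,
    forall i, `|zeta 0 i - (t^-1 *: (X t x - x)) 0 i| <= e / 2.
  apply: filter_forall => i.
  have := mu_lim _ (Cb i); rewrite -zetaE mxE => /cvgrPdist_le /(_ (e / 2)).
  rewrite divr_gt0 // => /(_ isT); apply: filterS => t.
  by rewrite time_mean_coord.
have near_x : \forall t \near U, t^-1 * `|x| <= e / 2 /\ 0 < t.
  apply: filterS2 (U_gt 0) (U_gt (2 * `|x| / e)) => t t0 xt; split=> //.
  rewrite ler_pdivrMl // mulrA ler_pdivlMr // mulrC.
  by move: xt => /=; rewrite ltr_pdivrMr // mulrC => /ltW.
have [t [[Bt tx] [xt t0]]] := filter_ex (filterI (filterI UB near_coord) near_x).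
apply: Bt.
have -> : zeta - t^-1 *: X t x = (zeta - t^-1 *: (X t x - x)) - t^-1 *: x.
  by rewrite -addrA -opprD -scalerDr subrK.
rewrite (le_trans (ler_normB _ _)) // [e]splitr lerD //.
  apply: rV_norm_le; first by rewrite divr_ge0 // ltW.
  by move=> i; have := tx i; rewrite !mxE.
by rewrite normrZ gtr0_norm ?invr_gt0.
Qed.

End krylov_bogoliubov.

(** * Change of time along orbits *)

Lemma primitive_le (R : realType) (f g : R -> R) (t : R) :
  continuous f -> continuous g -> (forall s, f s <= g s) -> 0 <= t ->
  primitive f t <= primitive g t.
Proof.
move=> cf cg fg t0.
have := derive_le_increment (is_derive_primitive cf) (is_derive_primitive cg) t0.
by rewrite !primitive0 !subr0; apply.
Qed.

Lemma primitive_cst (R : realType) (c t : R) : primitive (fun=> c) t = c * t.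
Proof.
have cc : continuous (fun _ : R => c) by exact: cst_continuous.
by rewrite (primitive_unique t cc (is_derive_mull c)) mulr0 subr0.
Qed.

Lemma scaled_field_lipschitz (R : realType) (d : nat) (r : 'rV[R]_d -> R)
    (Phi : 'rV[R]_d -> 'rV[R]_d) : C1_per r -> C1_per Phi ->
  exists2 K, 0 <= K &
    forall x y, `|r x *: Phi x - r y *: Phi y| <= K * `|x - y|.
Proof.
move=> rC1 PC1.
have [Kr Kr0 HKr] := C1_per_lipschitz_scalar rC1.
have [KP KP0 HKP] := C1_per_lipschitz PC1.
have [[_ _ pr] [_ _ pP]] := (rC1, PC1).
have [Mr Mr0 HMr] := periodic_bounded (C1_per_continuous rC1) pr.
have [MP MP0 HMP] := periodic_bounded (C1_per_continuous PC1) pP.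
exists (Mr * KP + Kr * MP); first by rewrite addr_ge0 // mulr_ge0 // ltW.
move=> x y.
have -> : r x *: Phi x - r y *: Phi y =
    r x *: (Phi x - Phi y) + (r x - r y) *: Phi y.
  by rewrite scalerBr scalerBl addrA subrK.
rewrite (le_trans (ler_normD _ _)) // !normrZ mulrDl lerD //.
  by rewrite -mulrA ler_pM.
by rewrite mulrAC ler_pM.
Qed.

Section scaled_field.
Variables (R : realType) (d : nat) (r : 'rV[R]_d -> R).
Variable Phi : 'rV[R]_d -> 'rV[R]_d.
Hypotheses (rC1 : C1_per r) (PhiC1 : C1_per Phi).

Lemma scaled_field_continuous : continuous (fun x => r x *: Phi x).
Proof.
move=> x; apply: cvgZ; first exact: nbhs_filter.
  exact: C1_per_continuous rC1 x.
exact: C1_per_continuous PhiC1 x.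
Qed.

Lemma scaled_field_periodic : Defs.periodic (fun x => r x *: Phi x).
Proof. by case: rC1 PhiC1 => [_ _ pr] [_ _ pP] x k kZ; rewrite pr ?pP. Qed.

Lemma scaled_field_mean_cvg (Y : R -> 'rV[R]_d -> 'rV[R]_d) (zeta x : 'rV[R]_d) :
  is_flow (fun x => r x *: Phi x) Y ->
  rotation_set (fun x => r x *: Phi x) = [set zeta] ->
  t^-1 *: Y t x @[t --> +oo] --> zeta.
Proof.
have [K K0 HK] := scaled_field_lipschitz rC1 PhiC1.
move=> Yflow; apply: rotation_singleton_cvg K0 HK _ _ Yflow _.
- exact: scaled_field_periodic.
- exact: scaled_field_continuous.
Qed.

End scaled_field.

Lemma rotation_singleton_flow (R : realType) (d : nat)
    (b : 'rV[R]_d -> 'rV[R]_d) (zeta : 'rV[R]_d) :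
  rotation_set b = [set zeta] -> exists Y, is_flow b Y.
Proof.
move=> rot; have : rotation_set b zeta by rewrite rot.
by move=> [mu [Y Yflow _] _]; exists Y.
Qed.

Lemma periodic_pos_lower_bound (R : realType) (d : nat) (r : 'rV[R]_d -> R) :
  continuous r -> Defs.periodic r -> (forall x, 0 < r x) ->
  exists2 m, 0 < m & forall x, m <= r x.
Proof.
move=> cr pr r0.
have [||M M0 HM] := @periodic_bounded R d R (fun x => (r x)^-1).
- by move=> x; apply: cvgV; [exact: nbhs_filter|rewrite gt_eqF|exact: cr].
- by move=> x k kZ; rewrite pr.
exists M^-1; first by rewrite invr_gt0.
move=> x; rewrite -[leRHS]invrK lef_pV2 ?posrE ?invr_gt0 //.
by have := HM x; rewrite ger0_norm // invr_ge0 ltW.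
Qed.

Section clock.
Variables (R : realType) (d : nat) (Phi : 'rV[R]_d -> 'rV[R]_d).
Variables (r r1 : 'rV[R]_d -> R) (Y : R -> 'rV[R]_d -> 'rV[R]_d).
Variable (u : R -> 'rV[R]_d).
Hypotheses (PhiC1 : C1_per Phi) (r1C1 : C1_per r1) (rC0 : C0_per r).
Hypothesis r1_gt0 : forall x, 0 < r1 x.
Hypothesis Yflow : is_flow (fun x => r1 x *: Phi x) Y.
Hypothesis du : forall t : R, is_derive t 1 u (r (u t) *: Phi (u t)).

Let rate s := r (u s) / r1 (u s).

(** The time spent by the flow of [r1 *: Phi] to describe the piece of orbit that [u],
an orbit of [r *: Phi], describes between the times 0 and [t]. *)
Definition clock : R -> R := primitive rate.

Lemma rate_continuous : continuous rate.
Proof.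
have cu : continuous u by move=> t; exact: is_derive_continuous (du t).
case: rC0 => cr _ t; apply: cvgM.
  by apply: continuous_comp; [exact: cu|exact: cr].
apply: cvgV; first by rewrite gt_eqF.
by apply: continuous_comp; [exact: cu|exact: C1_per_continuous r1C1 _].
Qed.

(** Both sides solve the time-dependent equation [y' = rate s *: (r1 y *: Phi y)],
whose field is Lipschitz in [y] because [rate] is bounded.  Nothing is divided by
[r], which may vanish. *)
Lemma time_change t : Y (clock t) (u 0) = u t.
Proof.
have [K K0 HK] := scaled_field_lipschitz r1C1 PhiC1.
case: (rC0) => cr pr; case: (r1C1) => _ _ pr1.
have [||M M0 HM] := @periodic_bounded R d R (fun x => r x / r1 x).
- move=> x; apply: cvgM; [exact: nbhs_filter|exact: cr|].
  by apply: cvgV; [exact: nbhs_filter|rewrite gt_eqF|exact: C1_per_continuous r1C1 x].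
- by move=> x k kZ; rewrite pr ?pr1.
have MK0 : 0 <= M * K by rewrite mulr_ge0 // ltW.
pose F (s : R) y := rate s *: (r1 y *: Phi y).
have FK s y z : `|F s y - F s z| <= M * K * `|y - z|.
  by rewrite -scalerBr normrZ -mulrA ler_pM //; exact: HM.
have dYT (s : R) : is_derive s 1 (Y ^~ (u 0) \o clock) (F s (Y (clock s) (u 0))).
  exact: is_derive_reparam ((Yflow (u 0)).2 _) (is_derive_primitive rate_continuous s).
have duF (s : R) : is_derive s 1 u (F s (u s)).
  apply: is_derive_eq (du s) _; rewrite /F /rate scalerA divfK //.
  by rewrite gt_eqF.
have := ode_unique MK0 FK dYT duF; rewrite /= /clock primitive0.
by rewrite (Yflow (u 0)).1 => /(_ erefl)/(congr1 (@^~ t)).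
Qed.

Lemma clock_bounds (m M t : R) : (forall s, m <= rate s <= M) -> 0 < t ->
  m <= t^-1 * clock t <= M.
Proof.
move=> mM t0; rewrite ler_pdivlMl // ler_pdivrMl // [t * m]mulrC [t * M]mulrC.
have cc (c : R) : continuous (fun _ : R => c) by exact: cst_continuous.
apply/andP; split; rewrite -primitive_cst; apply: primitive_le;
  rewrite ?(ltW t0) //; try exact: rate_continuous;
  by move=> s; case/andP: (mM s).
Qed.

Lemma clock_infty (m : R) : 0 < m -> (forall s, m <= rate s) ->
  clock t @[t --> +oo] --> +oo.
Proof.
move=> m0 mq; apply/cvgryPge => A; near=> t.
have t0 : 0 < t by near: t; apply: nbhs_pinfty_gt; exact: num_real.
have At : A / m <= t by near: t; apply: nbhs_pinfty_ge; exact: num_real.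
have cm : continuous (fun _ : R => m) by exact: cst_continuous.
rewrite (@le_trans _ _ (m * t)) //; first by rewrite mulrC -ler_pdivrMr.
rewrite -primitive_cst; apply: primitive_le (ltW t0) => //.
exact: rate_continuous.
Unshelve. all: by end_near. Qed.

Lemma clock_mean_cvg (zeta : 'rV[R]_d) (m : R) :
  rotation_set (fun x => r1 x *: Phi x) = [set zeta] ->
  0 < m -> (forall s, m <= rate s) ->
  (clock t)^-1 *: u t @[t --> +oo] --> zeta.
Proof.
move=> rot m0 mq.
rewrite (_ : (fun t => _) = (fun s => s^-1 *: Y s (u 0)) \o clock).
  apply: cvg_comp (clock_infty m0 mq) _.
  exact: (@scaled_field_mean_cvg _ _ _ _ r1C1 PhiC1 Y zeta (u 0) Yflow rot).
by apply/funext => t /=; rewrite time_change.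
Qed.

End clock.

(** A term close to the infimum bounds all later terms, up to a small error. *)
Lemma cvg_eventually_le (R : realType) (c : nat -> R) :
  (forall n, 0 <= c n) ->
  (forall N e, 0 < e -> \forall n \near \oo, c n <= c N + e) ->
  c n @[n --> \oo] --> inf (range c).
Proof.
move=> c0 cN.
have c_inf : has_inf (range c).
  by split; [exists (c 0%N); exists 0%N|exists 0 => _ [n _ <-]].
apply/cvgrPdist_le => e e0; have e2 : 0 < e / 2 by rewrite divr_gt0.
have [_ [N _ <-] cNe] := inf_adherent e2 c_inf.
apply: filterS (cN N _ e2) => n cnN.
have inf_le : inf (range c) <= c n.
  by apply: ge_inf; [case: c_inf|exists n].
rewrite distrC ger0_norm ?subr_ge0 //; lra.
Qed.

(** The ratio [rho_ 0 / rho_ n] is averaged along one orbit [u] of [rho_ 0 *: Phi].  A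
single ultrafilter gives limits [a n] of these averages for all [n] at once, and
the time change yields [zeta_ 0 = a n *: zeta_ n], also when [zeta_ 0] is 0.  The
bound from above of [rho_ n] by [rho_ N + eta] makes [a n] at least [a N - e]
eventually. *)
Lemma rotation_vectors_cvg (R : realType) (d : nat)
    (rho : 'rV[R]_d -> R) (Phi : 'rV[R]_d -> 'rV[R]_d)
    (rho_ : nat -> 'rV[R]_d -> R) (zeta_ : nat -> 'rV[R]_d) :
  C1_per Phi -> (forall n, C1_per (rho_ n)) ->
  (forall n x, rho x <= rho_ n x) -> (forall n x, 0 < rho_ n x) ->
  (forall e, 0 < e -> \forall n \near \oo, forall x, rho_ n x <= rho x + e) ->
  (forall n, rotation_set (fun x => rho_ n x *: Phi x) = [set zeta_ n]) ->
  exists zeta : 'rV[R]_d, zeta_ @ \oo --> zeta.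
Proof.
move=> PhiC1 rho_C1 rho_le rho_gt0 rho_near rot.
have [Y Yflow] := rotation_singleton_flow (rot 0%N).
have C0 n : C0_per (rho_ n).
  by split; [exact: C1_per_continuous (rho_C1 n)|case: (rho_C1 n)].
have /choice[del del_le] n : exists m, 0 < m /\ forall x, m <= rho_ n x.
  have [cn pn] := C0 n.
  by have [m m0 Hm] := periodic_pos_lower_bound cn pn (rho_gt0 n); exists m.
have /choice[M M_ge] n : exists M, 0 < M /\ forall x, `|rho_ n x| <= M.
  have [cn pn] := C0 n.
  by have [m m0 Hm] := periodic_bounded cn pn; exists m.
pose u := Y ^~ 0; have du (t : R) := (Yflow 0).2 t.
pose T n := clock (rho_ 0%N) (rho_ n) u.
pose q n s := rho_ 0%N (u s) / rho_ n (u s).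
have cq n : continuous (q n) by exact: rate_continuous.
pose lo n := del 0%N / M n; pose hi n := M 0%N / del n.
have lo_gt0 n : 0 < lo n.
  by rewrite divr_gt0 //; [case: (del_le 0%N)|case: (M_ge n)].
have q_bounds n s : lo n <= q n s <= hi n.
  have [d0 /(_ (u s)) d0_le] := del_le 0%N; have [dn /(_ (u s)) dn_le] := del_le n.
  have [M0 /(_ (u s)) M0_ge] := M_ge 0%N; have [Mn /(_ (u s)) Mn_ge] := M_ge n.
  rewrite !gtr0_norm // in M0_ge Mn_ge.
  rewrite /q /lo /hi; apply/andP; split.
    by rewrite ler_pM ?invr_ge0 ?lef_pV2 ?posrE // ltW.
  by rewrite ler_pM ?invr_ge0 ?lef_pV2 ?posrE // ltW.
have [U [UU infU]] := ultraFilterLemma (proper_pinfty_nbhs (R := R)).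
have U_gt (r : R) : U [set t | r < t].
  by apply: infU; apply: nbhs_pinfty_gt; exact: num_real.
have T_bounds n t : 0 < t -> lo n <= t^-1 * T n t <= hi n.
  exact: (clock_bounds (rho_C1 n) (C0 0%N) (rho_gt0 n) du (q_bounds n)).
have /choice[a a_lim] n : exists a : R, (fun t => t^-1 * T n t) @ U --> a.
  apply: (@ultra_bounded_cvg _ _ U _ (hi n)).
  apply: filterS (U_gt 0) => t t0; have /andP[Tlo Thi] := T_bounds n t t0.
  by rewrite ger0_norm // (le_trans _ Tlo) // ltW.
have a_gt0 n : 0 < a n.
  apply: (lt_le_trans (lo_gt0 n)).
  rewrite -(cvg_lim (@Rhausdorff R) (a_lim n)).
  apply: (limr_ge (cvgP _ (a_lim n))); apply: filterS (U_gt 0) => t t0.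
  by have /andP[] := T_bounds n t t0.
have zetaE n : zeta_ n = (a n)^-1 *: zeta_ 0%N.
  have [Yn Ynflow] := rotation_singleton_flow (rot n).
  have mean0 : t^-1 *: u t @[t --> U] --> zeta_ 0%N.
    apply: cvg_trans (@scaled_field_mean_cvg _ _ _ _ (rho_C1 0%N) PhiC1 Y
      (zeta_ 0%N) 0 Yflow (rot 0%N)).
    by move=> P; exact: infU.
  have meann : t^-1 *: u t @[t --> U] --> a n *: zeta_ n.
    have lo_q s : lo n <= q n s by case/andP: (q_bounds n s).
    have wn : (T n t)^-1 *: u t @[t --> U] --> zeta_ n.
      apply: cvg_trans (clock_mean_cvg PhiC1 (rho_C1 n) (C0 0%N) (rho_gt0 n)
        Ynflow du (rot n) (lo_gt0 n) lo_q).
      by move=> P; exact: infU.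
    apply: cvg_trans (cvgZ (a_lim n) wn); apply: near_eq_cvg.
    apply: filterS (U_gt 0) => t t0; rewrite scalerA mulfK //.
    have /andP[Tlo _] := T_bounds n t t0.
    apply: contraTneq Tlo => ->; rewrite mulr0 -ltNge //.
  have <- : a n *: zeta_ n = zeta_ 0%N := cvg_unique (@norm_hausdorff R _) meann mean0.
  by rewrite scalerA mulVf ?scale1r // gt_eqF.
have a_near N e : 0 < e -> \forall n \near \oo, a N - e <= a n.
  move=> e0; have [dN dN_le] := del_le N; have [M0 M0_ge] := M_ge 0%N.
  (* The inverses of [rho_ N] and [rho_ n] differ by at most [eta / del N ^+ 2]
     where [rho_ n] is the larger one, and [rho_ 0] is at most [M 0]. *)
  pose eta := e * del N ^+ 2 / M 0%N.
  have eta0 : 0 < eta by rewrite divr_gt0 ?mulr_gt0 ?exprn_gt0.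
  apply: filterS (rho_near eta eta0) => n rho_n.
  have q_le s : - e * 1 + q N s <= q n s.
    rewrite mulr1 addrC lerBlDr -lerBlDl /q -mulrBr.
    set y := u s; have r0_gt0 := rho_gt0 0%N y.
    have rN_ge : del N <= rho_ N y := dN_le y.
    have rN0 := rho_gt0 N y; have rn0 := rho_gt0 n y.
    have rnN : rho_ n y - rho_ N y <= eta.
      by rewrite lerBlDl (le_trans (rho_n y)) // lerD2r.
    have [rnN_le|rN_lt] := leP (rho_ n y) (rho_ N y).
      rewrite (le_trans _ (ltW e0)) // pmulr_rle0 // subr_le0.
      by rewrite lef_pV2 ?posrE.
    have diffE : (rho_ N y)^-1 - (rho_ n y)^-1 =
        (rho_ n y - rho_ N y) / (rho_ N y * rho_ n y).
      by field; rewrite !gt_eqF.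
    have -> : e = M 0%N * (eta / del N ^+ 2).
      by rewrite /eta; field; rewrite !gt_eqF.
    rewrite diffE ler_pM //.
    - exact: ltW.
    - by rewrite divr_ge0 ?subr_ge0 ?mulr_ge0 // ltW.
    - by rewrite (le_trans _ (M0_ge y)) // ler_norm.
    rewrite ler_pM ?subr_ge0 ?invr_ge0 ?mulr_ge0 ?(ltW rN0) ?(ltW rn0) ?(ltW rN_lt) //.
    rewrite lef_pV2 ?posrE ?mulr_gt0 ?exprn_gt0 // expr2 ler_pM ?(ltW dN) //.
    exact: le_trans rN_ge (ltW rN_lt).
  have T_le t : 0 < t -> - e <= t^-1 * T n t - t^-1 * T N t.
    move=> t0; rewrite -mulrBr ler_pdivlMl // lerBrDr.
    have c1 : continuous (fun _ : R => 1 : R) by exact: cst_continuous.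
    have cNe : continuous (fun s => - e * 1 + q N s).
      by move=> s; apply: cvgD; [exact: cvg_cst|exact: cq].
    have := primitive_le cNe (cq n) q_le (ltW t0).
    by rewrite (primitive_linear _ _ c1 (cq N)) primitive_cst mul1r mulrC.
  have aB : (fun t => t^-1 * T n t - t^-1 * T N t) @ U --> a n - a N.
    by apply: cvgB; [exact: a_lim|exact: a_lim].
  suff : - e <= a n - a N by lra.
  rewrite -(cvg_lim (@Rhausdorff R) aB).
  by apply: (limr_ge (cvgP _ aB)); apply: filterS (U_gt 0) => t; exact: T_le.
have c_cvg : (a n)^-1 @[n --> \oo] --> inf (range (fun n => (a n)^-1)).
  apply: cvg_eventually_le => [n|N e e0]; first by rewrite invr_ge0 ltW.
  have den0 : 0 < (a N)^-1 + e by rewrite ltr_wpDl // invr_ge0 ltW.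
  have e'0 : 0 < a N - ((a N)^-1 + e)^-1.
    rewrite subr_gt0 -[ltRHS]invrK ltf_pV2 ?posrE ?invr_gt0 //.
    by rewrite ltrDl.
  apply: filterS (a_near N _ e'0) => n.
  rewrite subKr => an; rewrite -[leRHS]invrK lef_pV2 ?posrE ?invr_gt0 //.
exists (inf (range (fun n => (a n)^-1)) *: zeta_ 0%N).
have lim0 : (a n)^-1 *: zeta_ 0%N @[n --> \oo] -->
    inf (range (fun n => (a n)^-1)) *: zeta_ 0%N by exact: cvgZ c_cvg (cvg_cst _).
apply: cvg_trans lim0; apply: near_eq_cvg; apply: nearW => n.
by rewrite [RHS]zetaE.
Qed.

(** * Orbits on which the limit speed stays positive *)

Lemma uniform_cvg_near (R : realType) (T : choiceType) (f_ : nat -> T -> R)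
    (f : T -> R) : {uniform, f_ @ \oo --> f} ->
  forall e, 0 < e -> \forall n \near \oo, forall x, `|f x - f_ n x| < e.
Proof.
move=> f_cvg e e0; apply: (f_cvg [set h | forall x, `|f x - h x| < e]).
apply/uniform_nbhs; exists [set xy | `|xy.1 - xy.2| < e]; split.
  by rewrite -entourage_ballE; exists e.
by move=> h H x; exact: H.
Qed.

(** With [T] the clock of [rho_ n *: Phi] along [u], [t^-1 *: u t] is the product of
[t^-1 * T t], which lies in [1 - eta, 1] because [rho_ n <= rho + eta * c] and
[c <= rho] along [u], and of [(T t)^-1 *: u t], which tends to [zeta_ n]. *)
Lemma positive_orbit_cvg (R : realType) (d : nat)
    (rho : 'rV[R]_d -> R) (Phi : 'rV[R]_d -> 'rV[R]_d)
    (rho_ : nat -> 'rV[R]_d -> R) (zeta_ : nat -> 'rV[R]_d)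
    (zeta : 'rV[R]_d) (u : R -> 'rV[R]_d) (c : R) :
  C1_per rho -> C1_per Phi -> (forall n, C1_per (rho_ n)) ->
  (forall n x, rho x <= rho_ n x) -> (forall n x, 0 < rho_ n x) ->
  (forall e, 0 < e -> \forall n \near \oo, forall x, rho_ n x <= rho x + e) ->
  (forall n, rotation_set (fun x => rho_ n x *: Phi x) = [set zeta_ n]) ->
  zeta_ @ \oo --> zeta ->
  (forall t : R, is_derive t 1 u (rho (u t) *: Phi (u t))) ->
  0 < c -> (forall t, c <= rho (u t)) ->
  t^-1 *: u t @[t --> +oo] --> zeta.
Proof.
move=> rhoC1 PhiC1 rho_C1 rho_le rho_gt0 rho_near rot zeta_cvg du c0 c_le.
apply/cvgrPdist_le => e e0; have e3 : 0 < e / 3 by rewrite divr_gt0.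
pose Z := `|zeta| + e; have Z0 : 0 < Z by rewrite ltr_wpDl.
(* [Z] bounds the norm of [zeta_ n] for the rank chosen below; the bound
   [2^-1] keeps the rate of the clock positive. *)
pose eta := Num.min (e / 3 / Z) 2^-1.
have eta0 : 0 < eta by rewrite lt_min !divr_gt0 //= invr_gt0.
have near_zeta : \forall n \near \oo, `|zeta - zeta_ n| <= e / 3.
  move/cvgrPdist_le : zeta_cvg; exact.
have [n [n_zeta n_rho]] := filter_ex (filterI near_zeta (rho_near _ (mulr_gt0 eta0 c0))).
have [Y Yflow] := rotation_singleton_flow (rot n).
have C0 : C0_per rho by split; [exact: C1_per_continuous rhoC1|case: rhoC1].
have rate_bounds s : 1 - eta <= rho (u s) / rho_ n (u s) <= 1.
  set y := u s; have rn0 := rho_gt0 n y; apply/andP; split.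
    rewrite ler_pdivlMr // mulrBl mul1r lerBlDr (le_trans (n_rho y)) //.
    by rewrite lerD2l ler_wpM2l ?(ltW eta0) // (le_trans (c_le s)) // rho_le.
  by rewrite ler_pdivrMr // mul1r.
have lo0 : 0 < 1 - eta.
  have : eta <= 2^-1 by rewrite ge_min lexx orbT.
  lra.
have lo_rate s : 1 - eta <= rho (u s) / rho_ n (u s).
  by case/andP: (rate_bounds s).
pose T := clock rho (rho_ n) u.
have T_bounds t : 0 < t -> 1 - eta <= t^-1 * T t <= 1.
  exact: (clock_bounds (rho_C1 n) C0 (rho_gt0 n) du rate_bounds).
have w_cvg := clock_mean_cvg PhiC1 (rho_C1 n) C0 (rho_gt0 n) Yflow du (rot n)
  lo0 lo_rate.
near=> t.
have t0 : 0 < t by near: t; apply: nbhs_pinfty_gt; exact: num_real.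
have w_near : `|zeta_ n - (T t)^-1 *: u t| <= e / 3.
  by near: t; move/cvgrPdist_le : w_cvg; exact.
have /andP[Tlo Thi] := T_bounds t t0; pose s := t^-1 * T t.
have T0 : T t != 0.
  by apply: contraTneq Tlo => ->; rewrite mulr0 -ltNge.
have -> : t^-1 *: u t = s *: ((T t)^-1 *: u t) by rewrite scalerA mulfK.
have -> : zeta - s *: ((T t)^-1 *: u t) =
    (zeta - zeta_ n) + (1 - s) *: zeta_ n + s *: (zeta_ n - (T t)^-1 *: u t).
  rewrite scalerBl scale1r scalerBr addrA; set w := s *: _.
  by rewrite addrA subrK subrK.
have s0 : 0 <= s by rewrite (le_trans _ Tlo) // ltW.
have -> : e = e / 3 + e / 3 + e / 3 by field.
rewrite (le_trans (ler_normD _ _)) // lerD //; last first.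
  rewrite normrZ ger0_norm // -[leRHS]mul1r ler_pM //.
rewrite (le_trans (ler_normD _ _)) // lerD //.
rewrite normrZ ger0_norm ?subr_ge0 //.
have zn_le : `|zeta_ n| <= Z.
  rewrite -[zeta_ n](subKr zeta) (le_trans (ler_normB _ _)) // lerD2l.
  rewrite (le_trans n_zeta) // ler_pdivrMr // ler_peMr ?(ltW e0) //.
  by rewrite ler1n.
have s_le : 1 - s <= e / 3 / Z.
  have : eta <= e / 3 / Z by rewrite ge_min lexx.
  by move: Tlo; rewrite -/s; lra.
have -> : e / 3 = e / 3 / Z * Z by rewrite divfK // gt_eqF.
by rewrite ler_pM ?subr_ge0.
Unshelve. all: by end_near. Qed.

Theorem corollary3p2 (R : realType) (d : nat)
  (rho : 'rV[R]_d -> R) (Phi : 'rV[R]_d -> 'rV[R]_d)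
  (rho_ : nat -> 'rV[R]_d -> R) (zeta_ : nat -> 'rV[R]_d)
  (X : R -> 'rV[R]_d -> 'rV[R]_d)
  (rhoC1 : C1_per rho)
  (rho_ge0 : forall x, 0 <= rho x)
  (rho_neq0 : exists x, rho x != 0)
  (rho_vanishes : exists x, rho x = 0)
  (PhiC1 : C1_per Phi)
  (Phi_neq0 : forall x, Phi x != 0)
  (rho_C1 : forall n, C1_per (rho_ n))
  (rho_le : forall n x, rho x <= rho_ n x)
  (rho_gt0 : forall n x, 0 < rho_ n x)
  (rho_cvg : {uniform, rho_ @ \oo --> rho})
  (rotation_singleton :
    forall n, rotation_set (fun x => rho_ n x *: Phi x) = [set zeta_ n])
  (Xflow : is_flow (fun x => rho x *: Phi x) X) :
  exists2 zeta : 'rV[R]_d, zeta_ @ \oo --> zeta &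
    forall x : 'rV[R]_d,
      orbit_closure X x `&` zero_set rho = set0 ->
      t^-1 *: X t x @[t --> +oo] --> zeta.
Proof.
have rho_near e : 0 < e -> \forall n \near \oo, forall x, rho_ n x <= rho x + e.
  move=> e0; apply: filterS (uniform_cvg_near rho_cvg e0) => n H x.
  by have := H x; rewrite distrC => /(le_lt_trans (ler_norm _)); lra.
have [zeta zeta_cvg] :=
  rotation_vectors_cvg PhiC1 rho_C1 rho_le rho_gt0 rho_near rotation_singleton.
exists zeta => // x F0.
have crho := C1_per_continuous rhoC1.
have prho : Defs.periodic rho by case: rhoC1.
have [c c0 c_le] := orbit_closure_lower_bound crho prho rho_ge0 F0.
exact: (positive_orbit_cvg rhoC1 PhiC1 rho_C1 rho_le rho_gt0 rho_near
  rotation_singleton zeta_cvg (Xflow x).2 c0 c_le).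
Qed.
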